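(* Let $p$ be a symmetric nc polynomial in $g$ symmetric variables, and let $\mathcal S=\bigcup_{n\ge1}\mathcal S_n$ be a subset of $\mathcal V(p)$ which respects direct sums and for which $\mathcal S_1$ is nonempty. (A) (i) The limit $$C_\pm(\mathcal S):=\lim_{n\uparrow\infty}\left(\sup\left\{\frac{c^n_\pm(X,v;p)}{n}:(X,v)\in\mathcal S_n\right\}\right)$$ exists. (ii) If $p$ is a $0$-minimum degree defining polynomial for $\mathcal S$, then $$\deg p\le 2\,C_\pm(\mathcal S)+2.$$ (B) Moreover: if $C_-(\mathcal S)=0$, then $p$ is a convex polynomial of degree $2$; if $C_+(\mathcal S)=0$, then $p$ is a concave polynomial of degree $2$. (C) Conversely, if $p$ is convex (resp., concave), then $p$ has degree at most two and $c^n_-(X,v;p)=0$ (resp., $c^n_+(X,v;p)=0$) for every $(X,v)\in(\mathbb R^{n\times n}_{sym})^g\times\mathbb R^n$. (D) Finally, if $\mathcal S'=\bigcup_n\mathcal S'_n$ is any other subset of $\mathcal V(p)$ for which $\mathcal S'_1\neq\emptyset$ and $p$ is a $0$-minimum degree defining polynomial, then $C_\pm(\mathcal S)=C_\pm(\mathcal S')$.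
   Context: Nc polynomials: $x=(x_1,\dots,x_g)$ are noncommuting indeterminates and $\mathbb R\langle x\rangle$ is the set of finite real linear combinations of words in $x$ (including the empty word); the degree is the maximal length of a word appearing nontrivially. The involution $T$ reverses words, with $x_j^T=x_j$ (the variables are ''symmetric''), and is extended linearly; $p$ is symmetric if $p^T=p$. For $X=(X_1,\dots,X_g)\in(\mathbb R^{n\times n}_{sym})^g$ (a $g$-tuple of real symmetric $n\times n$ matrices), $p(X)$ is the $n\times n$ matrix obtained by substitution, the constant term $c$ becoming $cI_n$. Derivatives: $p'(X)[H]=\frac{d}{dt}\big|_{t=0}p(X+tH)$ and $p''(X)[H]=\frac{d^2}{dt^2}\big|_{t=0}p(X+tH)$ for $X,H\in(\mathbb R^{n\times n}_{sym})^g$. Convexity: a symmetric $p$ is (matrix) convex if $p(tX+(1-t)Y)\preceq tp(X)+(1-t)p(Y)$ for all $n$, all $X,Y\in(\mathbb R^{n\times n}_{sym})^g$ and $0\le t\le1$; it is concave if $-p$ is convex. Variety: $\mathcal V(p)=\bigcup_{n\ge1}\mathcal V_n(p)$, $\mathcal V_n(p)=\{(X,v)\in(\mathbb R^{n\times n}_{sym})^g\times\mathbb R^n: p(X)v=0\}$. For a subset $\mathcal S=\bigcup_n\mathcal S_n$ of $\mathcal V(p)$, $\mathcal S_n\subseteq\mathcal V_n(p)$ is the part of size $n$. Direct sums: given $(X^j,v^j)\in(\mathbb R^{n_j\times n_j}_{sym})^g\times\mathbb R^{n_j}$, $j=1,\dots,t$, put $X_F=\mathrm{diag}\{X^1,\dots,X^t\}$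 (block diagonal in each of the $g$ coordinates) and $v_F=\mathrm{col}(v^1,\dots,v^t)$. A set $\mathcal S=\bigcup_n\mathcal S_n$ with $\mathcal S_n\subseteq(\mathbb R^{n\times n}_{sym})^g\times\mathbb R^n$ respects direct sums if, for every finite list of $(X^j,v^j)\in\mathcal S_{n_j}$ (repetitions allowed), $(X_F,v_F)\in\mathcal S_n$ with $n=\sum_j n_j$. Signature: for $(X,v)\in(\mathbb R^{n\times n}_{sym})^g\times\mathbb R^n$, $c^n_+(X,v;p)$ (resp. $c^n_-(X,v;p)$) is the maximum dimension of a subspace of $\mathcal T=\{H\in(\mathbb R^{n\times n}_{sym})^g:p'(X)[H]v=0\}$ on which $\langle p''(X)[H]v,v\rangle>0$ (resp. $<0$) for all nonzero $H$. Statements with $\pm$ are asserted for each sign. $C_\pm(\mathcal S')$ is defined by the same formula as $C_\pm(\mathcal S)$, with $\mathcal S'_n$ in place of $\mathcal S_n$. $0$-minimum degree defining polynomial: a symmetric nc polynomial $p$ is a $0$-minimum degree defining polynomial for $\mathcal S\subseteq\mathcal V(p)$ if (1) $\mathcal S$ is nonempty; (2) every nonzero (not necessarily symmetric) nc polynomial $q$ with $q(X)v=0$ for all $(X,v)\in\mathcal S$ satisfies $\deg q\ge\deg p$; (3) there exists a (not necessarily symmetric) nc polynomial $q$ with $\deg q=\deg p$ and $q(X)v=0$ for all $(X,v)\in\mathcal S$.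
   Formalization: (B) assumes p is a 0-minimum degree defining polynomial for S and concludes degree at most 2, not exactly 2 (p=x_1 has degree 1). (D) assumes S' also respects direct sums and p is a 0-minimum degree defining polynomial for both S and S'; without these the claims fail. *)

(* Defs.v *)
From HB Require Import structures.
From mathcomp Require Import all_boot all_order all_algebra finmap.
(* monalg has to be imported before mathcomp-analysis: their notations clash in
   the other order. *)
From mathcomp Require Import monalg.
From mathcomp Require Import all_classical all_reals all_analysis.

Set Implicit Arguments.
Unset Strict Implicit.
Unset Printing Implicit Defensive.

Import Order.TTheory GRing.Theory Num.Theory.
Import numFieldNormedType.Exports.

Local Open Scope classical_set_scope.
Local Open Scope ring_scope.

(* The free algebra R<x_1, ..., x_g>: the monoid algebra of the free monoid of
   words over 'I_g. *)
Notation ncpoly R g := {malg R[{fmonom 'I_g}]}.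

Notation mxtuple R g n := {ffun 'I_g -> 'M[R]_n}.

(* The zero polynomial gets degree 0. *)
Definition ncdeg (R : realType) (g : nat) (p : ncpoly R g) : nat :=
  \max_(w <- msupp p) fdeg w.

Definition nctr (R : realType) (g : nat) (p : ncpoly R g) : ncpoly R g :=
  \sum_(w <- msupp p) << p@_w *g FMonom (rev w) >>.

Definition nc_symmetric (R : realType) (g : nat) (p : ncpoly R g) : Prop :=
  nctr p = p.

Definition nceval (R : realType) (g : nat) (p : ncpoly R g) (n : nat)
    (X : mxtuple R g n) : 'M[R]_n :=
  \sum_(w <- msupp p) p@_w *: \prod_(i <- fmonom_val w) X i.

Definition symtuple (R : realType) (g n : nat) (X : mxtuple R g n) : Prop :=
  forall i, (X i)^T = X i.

(* Derivatives of the curve t |-> p(X + tH) at t = 0, taken entrywise. *)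
Definition ncder1 (R : realType) (g : nat) (p : ncpoly R g) (n : nat)
    (X H : mxtuple R g n) : 'M[R]_n :=
  \matrix_(i, j) derive1 (fun t : R => nceval p (X + t *: H) i j) 0.

Definition ncder2 (R : realType) (g : nat) (p : ncpoly R g) (n : nat)
    (X H : mxtuple R g n) : 'M[R]_n :=
  \matrix_(i, j) derive1n 2 (fun t : R => nceval p (X + t *: H) i j) 0.

(* <A v, v> *)
Definition qform (R : realType) (n : nat) (A : 'M[R]_n) (v : 'cV[R]_n) : R :=
  (v^T *m A *m v) 0 0.

Definition loewner_le (R : realType) (n : nat) (A B : 'M[R]_n) : Prop :=
  (B - A)^T = B - A /\ forall u : 'cV[R]_n, 0 <= qform (B - A) u.

Definition nc_convex (R : realType) (g : nat) (p : ncpoly R g) : Prop :=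
  forall (n : nat) (X Y : mxtuple R g n) (t : R),
    symtuple X -> symtuple Y -> 0 <= t <= 1 ->
    loewner_le (nceval p (t *: X + (1 - t) *: Y))
               (t *: nceval p X + (1 - t) *: nceval p Y).

Definition nc_concave (R : realType) (g : nat) (p : ncpoly R g) : Prop :=
  nc_convex (- p).

(* Graded sets S = \bigcup_(n >= 1) S_n of pairs (X, v).  The component S 0
   is a dummy, which the definitions below ignore. *)
Definition ncset (R : realType) (g : nat) : Type :=
  forall n : nat, set (mxtuple R g n * 'cV[R]_n).

Definition ncvariety (R : realType) (g : nat) (p : ncpoly R g) : ncset R g :=
  fun n => [set Xv | symtuple Xv.1 /\ nceval p Xv.1 *m Xv.2 = 0].

Definition ncsubset (R : realType) (g : nat) (S S' : ncset R g) : Prop :=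
  forall n : nat, (0 < n)%N -> S n `<=` S' n.

Definition respects_direct_sums (R : realType) (g : nat) (S : ncset R g) : Prop :=
  forall (t : nat) (n : 'I_t -> nat)
    (X : forall j, mxtuple R g (n j)) (v : forall j, 'cV[R]_(n j)),
    (0 < t)%N -> (forall j, (0 < n j)%N) ->
    (forall j, S (n j) (X j, v j)) ->
    S (\sum_j n j)%N
      ([ffun i => \mxdiag_(j < t) X j i], \mxcol_(j < t) v j).

Definition vanishes_on (R : realType) (g : nat) (q : ncpoly R g)
    (S : ncset R g) : Prop :=
  forall (n : nat) (X : mxtuple R g n) (v : 'cV[R]_n),
    (0 < n)%N -> S n (X, v) -> nceval q X *m v = 0.

Definition min_degree_defining0 (R : realType) (g : nat) (p : ncpoly R g)
    (S : ncset R g) : Prop :=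
  [/\ exists2 n : nat, (0 < n)%N & S n !=set0,
      forall q : ncpoly R g, q != 0 -> vanishes_on q S ->
        (ncdeg p <= ncdeg q)%N
    & exists2 q : ncpoly R g, ncdeg q = ncdeg p & vanishes_on q S].

(* The two signs are encoded as booleans through (-1) ^+ s: s = false stands for
   the subscript + and s = true for the subscript -. *)
Notation sgn_plus := false (only parsing).
Notation sgn_minus := true (only parsing).

Definition signed_subspace (s : bool) (R : realType) (g : nat) (p : ncpoly R g)
    (n : nat) (X : mxtuple R g n) (v : 'cV[R]_n)
    (U : {vspace mxtuple R g n}) : Prop :=
  forall H : mxtuple R g n, H \in U ->
    [/\ symtuple H, ncder1 p X H *m v = 0
      & H != 0 -> 0 < (-1) ^+ s * qform (ncder2 p X H) v].

Definition signature (s : bool) (R : realType) (g : nat) (p : ncpoly R g)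
    (n : nat) (X : mxtuple R g n) (v : 'cV[R]_n) : nat :=
  \max_(k < (\dim {: mxtuple R g n}).+1 |
        `[< exists2 U, signed_subspace s p X v U & \dim U = k >]) k.

(* The set is bounded (signature <= g * n ^ 2), so that the real-valued sup is
   the usual one as soon as S n is nonempty. *)
Definition signature_density (s : bool) (R : realType) (g : nat)
    (p : ncpoly R g) (S : ncset R g) (n : nat) : R :=
  sup [set (signature s p Xv.1 Xv.2)%:R / n%:R | Xv in S n].

Definition signature_limit (s : bool) (R : realType) (g : nat)
    (p : ncpoly R g) (S : ncset R g) : R :=
  limn (signature_density s p S).

(* Main.v *)
Require Import Defs.
From HB Require Import structures.
From mathcomp Require Import all_boot all_order all_algebra finmap.
From mathcomp Require Import monalg.
From mathcomp Require Import all_classical all_reals all_analysis.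
From mathcomp Require Import ring lra zify.

Set Implicit Arguments.
Unset Strict Implicit.
Unset Printing Implicit Defensive.

Import Order.TTheory GRing.Theory Num.Theory.
Import numFieldNormedType.Exports.

Local Open Scope classical_set_scope.
Local Open Scope ring_scope.

(** Let [d] be the degree of [p] and write [y_(jb) = H_j b(X) v].  Then
    [<p''(X)[H] v, v>] is twice the sum of [c(u^T m w) <m(X) y_w, y_u>] over
    words [u, w, m] with [u, w] nonempty, where [c] gives the coefficients of
    [p].  If [a] is the sequence of coefficients of [(1 - t)^(-1/2)], the
    unipotent substitution [z_w = sum over w = l w' of a_|l| l(X) y_w'] turns
    this into twice [sum of c(u^T w) <z_w, z_u>], so that only the constant
    Hankel matrix [(c(u^T w))_(u, w)], of inertia [(mu_+, mu_-)], matters.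
    Hence [c_(+-) <= n mu_(+-)] for all [(X, v)].  If the vectors [w(X) v] with
    [|w| < d] are linearly independent, then the vectors [y_w] are arbitrary up
    to symmetry conditions whose number does not depend on [n], and the values
    on words of length [d] can be used to solve [p'(X)[H] v = 0]; this gives
    [c_(+-) >= n mu_(+-) - K].  The minimum degree property and direct sums
    provide such a point in [S], a truncated Fock space provides one among all
    symmetric tuples, and replicating it shows that the limit is [mu_(+-)].
    The Hankel matrix vanishes for [|u| + |w| > d], and a word of length [d]
    with nonzero coefficient gives nonzero entries all along the antidiagonal
    [|u| + |w| = d], so that [d <= 2 mu_(+-) + 2].  The limit exists for
    any [S] by superadditivity (Fekete). *)

(** * Linear algebra *)

Section LinearAlgebra.
Variable F : fieldType.

Lemma linear_hom (U V : vectType F) (f : U -> V) :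
  linear f -> exists h : 'Hom(U, V), forall u, h u = f u.
Proof.
move=> lf; pose fL : {linear U -> V} := HB.pack f (GRing.isLinear.Build F U V _ f lf).
by exists (linfun fL) => u; rewrite lfunE.
Qed.

Lemma dimv_le_of_inj (U V : vectType F) (f : U -> V) (W : {vspace U}) :
  linear f -> (forall u, u \in W -> f u = 0 -> u = 0) ->
  (\dim W <= \dim {: V})%N.
Proof.
move=> /linear_hom[h hE] inj.
have <- : \dim (h @: W) = \dim W.
  apply: limg_dim_eq; apply/eqP; rewrite -subv0; apply/subvP => u.
  rewrite memv_cap memv_ker memv0 => /andP[uW /eqP hu].
  by apply/eqP/inj; rewrite // -hE.
exact: dimvS (subvf _).
Qed.

(** Rank-nullity: [M] is the image under [h] of the kernel of [f], on which [h] is injective.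
    Subspaces of directions are built this way, with [u] the parameters, [f] the constraints and
    [h u] the direction. *)
Lemma kernel_image (U V W : vectType F) (f : U -> V) (h : U -> W) :
    linear f -> linear h -> (forall u, f u = 0 -> h u = 0 -> u = 0) ->
  exists2 M : {vspace W}, (\dim {: U} <= \dim M + \dim {: V})%N &
    forall x, x \in M -> exists2 u, f u = 0 & x = h u.
Proof.
move=> /linear_hom[f' fE] /linear_hom[h' hE] inj.
exists (h' @: lker f')%VS; last first.
  move=> x /memv_imgP[u]; rewrite memv_ker fE => /eqP fu ->.
  by exists u; rewrite ?hE.
rewrite limg_dim_eq; last first.
  apply/eqP; rewrite -subv0; apply/subvP => u.
  rewrite memv_cap !memv_ker memv0 fE hE => /andP[/eqP fu /eqP hu].
  exact/eqP/inj.
rewrite -(limg_ker_dim f' fullv) capfv leq_add2l.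
exact: dimvS (subvf _).
Qed.

Lemma dimv_prod (U V : vectType F) :
  \dim {: (U * V)%type} = (\dim {: U} + \dim {: V})%N.
Proof. by rewrite !dimvf. Qed.

Lemma dimv_mx m n : \dim {: 'M[F]_(m, n)} = (m * n)%N.
Proof. by rewrite dimvf. Qed.

Lemma dimv_ffun (I : finType) (V : vectType F) :
  \dim {: {ffun I -> V}} = (#|I| * \dim {: V})%N.
Proof. by rewrite !dimvf. Qed.

End LinearAlgebra.

(** * Diagonalization of symmetric matrices by congruence *)

Section Congruence.
Variable R : realFieldType.

Lemma tr_mx11 (A : 'M[R]_1) : A^T = A.
Proof. by apply/matrixP => i j; rewrite mxE !ord1. Qed.

(** Polarization: a quadratic form that vanishes identically has a vanishing bilinear form, as 2 is
    invertible, and the bilinear form reads off the entries of [A]. *)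
Lemma sym_mx_nonisotropic n (A : 'M[R]_n) : A^T = A -> A != 0 ->
  exists v : 'rV[R]_n, (v *m A *m v^T) 0 0 != 0.
Proof.
move=> As; apply: contra_neqP => /forallNP iso.
have q0 (v : 'rV_n) : v *m A *m v^T = 0.
  by apply/matrixP => i j; rewrite !ord1 [RHS]mxE; apply/eqP/negPn/negP/iso.
have b0 (u v : 'rV_n) : u *m A *m v^T = 0.
  have /eqP := q0 (u + v).
  rewrite linearD /= !mulmxDl !mulmxDr !q0 addr0 add0r.
  have -> : v *m A *m u^T = u *m A *m v^T.
    by rewrite -[LHS]tr_mx11 !trmx_mul trmxK As mulmxA.
  rewrite -mulr2n -scaler_nat scaler_eq0 pnatr_eq0 /=.
  by move=> /eqP.
apply/matrixP => i j.
have := congr1 (fun B : 'M[R]_1 => B 0 0) (b0 (delta_mx 0 i) (delta_mx 0 j)).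
by rewrite -rowE trmx_delta -colE !mxE.
Qed.

(** Gaussian elimination writes [v], of rank one, as a nonzero scalar times the first row of the
    invertible matrix [row_ebase v]. *)
Lemma complete_row n (v : 'rV[R]_n.+1) : v != 0 ->
  exists2 T : 'M[R]_(1 + n), T \in unitmx & usubmx T = v.
Proof.
move=> v0; pose c := col_ebase v 0 0.
have rv : \rank v = 1%N by rewrite rank_rV v0.
have cu : c != 0.
  have := col_ebase_unit v; rewrite unitmxE det_mx11 unitfE; exact.
have vE : v = c *: usubmx (row_ebase v : 'M[R]_(1 + n)).
  rewrite -{1}(mulmx_ebase v) rv [col_ebase v]mx11_scalar -/c.
  rewrite mul_scalar_mx -scalemxAl; congr (_ *: _).
  apply/rowP => j; rewrite !mxE big_ord_recl !mxE /= mul1r big1 => [|i _].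
    by rewrite addr0; congr (row_ebase v _ j); apply/val_inj.
  by rewrite !mxE /= mul0r.
exists (c *: row_ebase v); last by rewrite linearZ /= -vE.
by rewrite unitmxZ ?row_ebase_unit // unitfE.
Qed.

(** Lagrange's reduction: a nonisotropic vector taken as first row of a change of basis produces a
    nonzero pivot [a]; clearing its row and column leaves the Schur complement [S], to which the
    induction applies. *)
Lemma sym_mx_congr_diag n (A : 'M[R]_n) : A^T = A ->
  exists Q : 'M[R]_n, exists D : 'rV[R]_n,
    Q \in unitmx /\ A = Q *m diag_mx D *m Q^T.
Proof.
elim: n A => [|n IH] A As.
  by exists 1%:M, 0; rewrite unitmx1; split=> //; apply/matrixP => -[].
have [->|/(sym_mx_nonisotropic As)[v vAv]] := eqVneq A 0.
  by exists 1%:M, 0; rewrite unitmx1; split=> //; rewrite linear0 mulmx0 mul0mx.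
have v0 : v != 0 by apply: contraNneq vAv => ->; rewrite !mul0mx mxE.
have [T Tu Tv] := complete_row v0.
pose B : 'M[R]_(1 + n) := T *m A *m T^T.
have Bs : B^T = B by rewrite /B !trmx_mul trmxK As mulmxA.
pose a := B 0 0.
have a0 : a != 0.
  have -> : a = (v *m A *m v^T) 0 0.
    have -> : v = row 0 T.
      by apply/rowP => j; rewrite -Tv !mxE; congr (T _ j); apply/val_inj.
    by rewrite -row_mul /a /B !mxE; apply: eq_bigr => k _; rewrite !mxE.
  exact: vAv.
pose b : 'M[R]_(1, n) := ursubmx B.
pose S : 'M[R]_n := drsubmx B - a^-1 *: (b^T *m b).
have [|Q [D [Qu SE]]] := IH S.
  rewrite /S linearB /= linearZ /= trmx_mul trmxK; congr (_ - _).
  by rewrite trmx_drsub Bs.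
have BE : B = block_mx a%:M b b^T (drsubmx B).
  rewrite -{1}[B]submxK; congr block_mx.
    rewrite [LHS]mx11_scalar; congr (_%:M); rewrite 2!mxE /a.
    by congr (B _ _); apply/val_inj.
  by rewrite trmx_ursub Bs.
pose L : 'M[R]_(1 + n) := block_mx 1%:M 0 (a^-1 *: b^T) Q.
pose E : 'rV_(1 + n) := row_mx a%:M D.
have Lu : L \in unitmx.
  by rewrite unitmxE /L (det_lblock 1%:M) det1 mul1r -unitmxE.
exists (invmx T *m L), E; split.
  by rewrite unitmx_mul unitmx_inv Tu; exact: Lu.
have LE : L *m diag_mx E *m L^T = B.
  rewrite BE /L /E diag_mx_row tr_block_mx !mulmx_block !trmx1 trmx0.
  rewrite !mul1mx !mulmx1 !mul0mx !mulmx0 !addr0 !add0r.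
  have -> : diag_mx (a%:M : 'rV_1) = a%:M.
    by apply/matrixP => i j; rewrite !ord1 !mxE !eqxx.
  rewrite linearZ /= trmxK -!scalemxAl mul_mx_scalar mul_scalar_mx scalerA.
  rewrite mulfV // scale1r mul0mx addr0 -scalemxAl !scalerA mulVf // !scale1r.
  by rewrite -scalemxAr -SE /S addrC subrK.
rewrite trmx_mul !mulmxA -(mulmxA (invmx T)) -(mulmxA (invmx T)) LE /B.
rewrite !mulmxA mulVmx // mul1mx -mulmxA -trmx_mul mulVmx // trmx1 mulmx1.
by [].
Qed.

End Congruence.

(** * Signs of a diagonalized form, and the square root of the geometric series *)

Section Inertia.
Variable R : realFieldType.

Definition inertia (s : bool) N (D : 'rV[R]_N) : nat :=
  #|[pred k | 0 < (-1) ^+ s * D 0 k]|.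

(** The rows of [z] are vectors with [n] coordinates, so each diagonal entry weighs [n] squares.
    This is the source of the factor [n] in the signature bounds. *)
Lemma trace_congr_diag N n (Q : 'M[R]_N) (D : 'rV[R]_N) (z : 'M[R]_(N, n)) :
  \tr (z^T *m (Q *m diag_mx D *m Q^T) *m z) =
  \sum_k D 0 k * \sum_j (Q^T *m z) k j ^+ 2.
Proof.
have -> : z^T *m (Q *m diag_mx D *m Q^T) *m z =
    (Q^T *m z)^T *m (diag_mx D *m (Q^T *m z)).
  by rewrite trmx_mul trmxK !mulmxA.
rewrite mxtrace_mulC /mxtrace; apply: eq_bigr => k _.
rewrite mxE mulr_sumr; apply: eq_bigr => j _.
by rewrite mul_diag_mx !mxE -mulrA expr2.
Qed.

Lemma trace_quadratic N n (A : 'M[R]_N) (z : 'M[R]_(N, n)) :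
  \tr (z^T *m A *m z) =
  \sum_u \sum_w A u w * (row u z *m (row w z)^T) 0 0.
Proof.
rewrite /mxtrace.
under eq_bigr => i _.
  rewrite mxE; under eq_bigr => w _.
    rewrite mxE mulr_suml.
    under eq_bigr => u _ do rewrite mxE [z u i * _]mulrC -mulrA.
    over.
  over.
rewrite exchange_big /= [RHS]exchange_big /=; apply: eq_bigr => w _.
rewrite exchange_big /=; apply: eq_bigr => u _.
by rewrite mxE mulr_sumr; apply: eq_bigr => i _; rewrite !mxE.
Qed.

Lemma signed_sum_le0 (s : bool) N (D : 'rV[R]_N) (a : 'I_N -> R) :
  (forall k, 0 <= a k) ->
  (forall k, 0 < (-1) ^+ s * D 0 k -> a k = 0) ->
  (-1) ^+ s * \sum_k D 0 k * a k <= 0.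
Proof.
move=> a0 aD; rewrite mulr_sumr; apply: sumr_le0 => k _; rewrite mulrA.
case: (ltP 0 ((-1) ^+ s * D 0 k)) => [/aD ->|D0]; first by rewrite mulr0.
exact: mulr_le0_ge0.
Qed.

(** On a vector [x] whose diagonal coordinates of sign [s] all vanish, the signed form is
    nonpositive; it is also the squared norm of [x]. Hence reading off these coordinates is
    injective. *)
Lemma inertia_ge (s : bool) N K (Q : 'M[R]_N) (D : 'rV[R]_N) (E : 'M[R]_(K, N)) :
  E *m (Q *m diag_mx D *m Q^T) *m E^T = ((-1) ^+ s)%:M ->
  (K <= inertia s D)%N.
Proof.
move=> EE.
pose f (x : 'rV[R]_K) : 'cV[R]_(inertia s D) :=
  \col_(k < inertia s D) (x *m E *m Q) 0 (enum_val k).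
have lf : linear f.
  move=> a x y; rewrite /f !mulmxDl -!scalemxAl.
  move: (x *m E *m Q) (y *m E *m Q) => {}x {}y.
  by apply/colP => k; rewrite !mxE.
have := @dimv_le_of_inj _ _ _ f fullv lf.
rewrite !dimv_mx mul1n muln1; apply=> x _ fx.
have := @signed_sum_le0 s N D (fun k => \sum_j (Q^T *m (x *m E)^T) k j ^+ 2).
rewrite -trace_congr_diag trmxK.
have -> : x *m E *m (Q *m diag_mx D *m Q^T) *m (x *m E)^T =
    (-1) ^+ s *: (x *m x^T).
  rewrite trmx_mul !mulmxA.
  have -> : x *m E *m Q *m diag_mx D *m Q^T *m E^T =
     x *m (E *m (Q *m diag_mx D *m Q^T) *m E^T) by rewrite !mulmxA.
  by rewrite EE mul_mx_scalar -scalemxAl.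
rewrite mxtraceZ mulrA -expr2 sqrr_sign mul1r => le0.
apply/rowP => i; rewrite mxE; apply/eqP; rewrite -sqrf_eq0.
have {}le0 : \tr (x *m x^T) <= 0.
  apply: le0 => [k|k Dk]; first by apply: sumr_ge0 => j _; apply: sqr_ge0.
  apply: big1 => j _; rewrite !ord1 -trmx_mul mxE.
  have := congr1 (fun A : 'cV[R]_(inertia s D) => A (enum_rank_in Dk k) 0) fx.
  by rewrite [LHS]mxE [RHS]mxE enum_rankK_in // => ->; rewrite expr0n.
move: le0; rewrite /mxtrace big_ord1 mxE.
under eq_bigr => j _ do rewrite mxE -expr2.
move=> le0; have : \sum_j x 0 j ^+ 2 == 0.
  by rewrite eq_le le0 sumr_ge0 // => j _; apply: sqr_ge0.
rewrite psumr_eq0 => [|j _]; last exact: sqr_ge0.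
by move=> /allP/(_ i (mem_index_enum _)).
Qed.

(* Coefficients of the power series [(1 - t) ^ (- 1 / 2)]. *)
Lemma sqrt_geometric (n : nat) : exists2 c : nat -> R, c 0%N = 1 &
  forall k, (k <= n)%N -> \sum_(i < k.+1) c i * c (k - i)%N = 1.
Proof.
elim: n => [|n [c c0 IH]].
  by exists (fun=> 1) => // -[|//] _; rewrite big_ord1 mulr1.
(* Since [c 0 = 1], the equation of order [n.+1] reads [2 * c n.+1 + m = 1], which fixes the new
   coefficient. *)
pose m := \sum_(i < n) c i.+1 * c (n - i)%N.
exists (fun k => if k == n.+1 then (1 - m) / 2 else c k) => // k.
rewrite leq_eqVlt => /predU1P[->|kn].
  rewrite big_ord_recl big_ord_recr /= /bump /= add1n subn0 subnn.
  rewrite (eqxx (n.+1 : nat)) c0 mul1r mulr1.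
  have -> : \sum_(i < n)
      (if (1 + i)%N == n.+1 then (1 - m) / 2 else c (1 + i)%N) *
      (if (n.+1 - (1 + i))%N == n.+1 then (1 - m) / 2
       else c (n.+1 - (1 + i))%N) = m.
    apply: eq_bigr => i _; rewrite add1n eqSS subSS.
    rewrite !ltn_eqF //; last by rewrite ltnS leq_subr.
  by field.
rewrite -[RHS](IH k kn); apply: eq_bigr => i _.
have ik : (i <= k)%N by rewrite -ltnS.
by rewrite !ltn_eqF // ltnS ?(leq_trans ik) // (leq_trans (leq_subr _ _)).
Qed.

End Inertia.

(** * Words and derivatives *)

Section Words.
Variables (R : realType) (g : nat).

Definition nccoef (p : ncpoly R g) (w : seq 'I_g) : R := p@_(FMonom w).

Definition wordmx n (X : mxtuple R g n) (w : seq 'I_g) : 'M[R]_n :=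
  \prod_(i <- w) X i.

Lemma wordmx_nil n (X : mxtuple R g n) : wordmx X [::] = 1%:M.
Proof. by rewrite /wordmx big_nil. Qed.

Lemma wordmx_cons n (X : mxtuple R g n) j w :
  wordmx X (j :: w) = X j *m wordmx X w.
Proof. by rewrite /wordmx big_cons. Qed.

Lemma wordmx_cat n (X : mxtuple R g n) u w :
  wordmx X (u ++ w) = wordmx X u *m wordmx X w.
Proof. by rewrite /wordmx big_cat. Qed.

Lemma wordmx_rev n (X : mxtuple R g n) w : symtuple X ->
  wordmx X (rev w) = (wordmx X w)^T.
Proof.
move=> Xs; elim: w => [|j w IH]; first by rewrite wordmx_nil trmx1.
rewrite rev_cons -cats1 wordmx_cat IH !wordmx_cons wordmx_nil mulmx1.
by rewrite trmx_mul Xs.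
Qed.

Lemma nccoef_eq0 p w : (ncdeg p < size w)%N -> nccoef p w = 0.
Proof.
move=> dw; apply: mcoeff_outdom; apply: contraL dw => wp.
rewrite -leqNgt /ncdeg (big_rem _ wp) /= leq_max.
by rewrite [X in (_ <= X)%N || _]fdegE leqnn.
Qed.

Lemma ncdeg_coef p : (0 < ncdeg p)%N ->
  exists2 w, size w = ncdeg p & nccoef p w != 0.
Proof.
move=> d0.
suff [w wp wE] : exists2 w, w \in (msupp p : seq _) & fdeg w = ncdeg p.
  by exists w; rewrite // /nccoef mcoeff_neq0; case: w wp {wE}.
move: d0; rewrite /ncdeg; elim: (msupp p : seq _) => [|w s IH].
  by rewrite big_nil.
rewrite big_cons; case: (leqP (fdeg w) (\max_(j <- s) fdeg j)) => h d0.
  have [w' w's wE] := IH d0.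
  by exists w'; rewrite // inE w's orbT.
by exists w; rewrite // inE eqxx.
Qed.

Lemma nccoef_rev p w : nc_symmetric p -> nccoef p (rev w) = nccoef p w.
Proof.
move=> ps; rewrite -[in LHS]ps /nccoef /nctr raddf_sum /=.
under eq_bigr => u _ do rewrite mcoeffU.
have [wp|wp] := boolP (FMonom w \in msupp p).
  rewrite (big_fsetD1 _ wp) /= eqxx mulr1n big1_fset ?addr0 // => u.
  rewrite !inE => /andP[uw _] _; case: eqP => // -[/(congr1 rev)].
  by rewrite !revK => uE; case/eqP: uw; case: u uE => u /= ->.
rewrite [RHS](mcoeff_outdom wp) big1_fset // => u up _.
case: eqP => // -[/(congr1 rev)]; rewrite !revK => uw.
by move: up wp; rewrite -uw; case: u {uw} => u /= ->.
Qed.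

(** Sums over the support become sums over a fixed finite type of words, which can be exchanged and
    regrouped. Any bound [m] on the degree will do, since the additional coefficients are 0. *)
Lemma sum_msupp (V : lmodType R) p m (F : seq 'I_g -> V) : (ncdeg p <= m)%N ->
  \sum_(w <- msupp p) p@_w *: F w = \sum_(w : m.-bseq 'I_g) nccoef p w *: F w.
Proof.
move=> dm.
have h : forall w, w \in msupp p -> (size w <= m)%N.
  move=> w wp; apply: leq_trans dm; rewrite leqNgt; apply/negP => /nccoef_eq0.
  by move/eqP; rewrite /nccoef mcoeff_eq0; case: w wp => w /= ->.
rewrite [RHS](bigID (fun w : m.-bseq 'I_g => FMonom w \in msupp p)) /=.
rewrite [X in _ + X]big1 ?addr0 => [|w wp]; last first.
  by rewrite /nccoef (mcoeff_outdom wp) scale0r.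
rewrite -[RHS]big_filter.
transitivity (\sum_(w <- [seq FMonom (bseqval w) | w : m.-bseq 'I_g <-
    [seq i : m.-bseq 'I_g <- index_enum (m.-bseq 'I_g) |
      FMonom (bseqval i) \in msupp p]])
      p@_w *: F w); last by rewrite big_map.
apply: perm_big. apply: uniq_perm; first exact: fset_uniq.
  rewrite map_inj_in_uniq ?filter_uniq ?index_enum_uniq //.
  by move=> u w _ _ [uw]; apply: val_inj.
move=> w; apply/idP/mapP => [wp|[u + ->]]; last first.
  by rewrite mem_filter => /andP[].
exists (Bseq (h w wp)); last by case: w wp.
by rewrite mem_filter mem_index_enum andbT; case: w wp.
Qed.

Lemma nceval_words p n (X : mxtuple R g n) m : (ncdeg p <= m)%N ->
  nceval p X = \sum_(w : m.-bseq 'I_g) nccoef p w *: wordmx X w.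
Proof. by move=> dm; rewrite -sum_msupp. Qed.

(* The coefficient of [t ^ k] in the word [w] evaluated at [X + t H]. *)
Fixpoint wordjet n (X H : mxtuple R g n) (k : nat) (w : seq 'I_g) : 'M[R]_n :=
  match w with
  | [::] => (k == 0)%:R%:M
  | j :: w' => X j *m wordjet X H k w' +
      (if k is k'.+1 then H j *m wordjet X H k' w' else 0)
  end.

Lemma wordjet0 n (X H : mxtuple R g n) w : wordjet X H 0 w = wordmx X w.
Proof.
by elim: w => [|j w IH] /=; rewrite ?wordmx_nil // wordmx_cons addr0 IH.
Qed.

Lemma wordmx_line n (X H : mxtuple R g n) (t : R) w m : (size w <= m)%N ->
  wordmx (X + t *: H) w = \sum_(k < m.+1) t ^+ k *: wordjet X H k w.
Proof.
elim: w m => [|j w IH] m /=.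
  move=> _; rewrite wordmx_nil big_ord_recl big1 /= => [|k _].
    by rewrite addr0 expr0 scale1r.
  by rewrite (_ : 0%:M = 0) ?scaler0 //; apply: raddf0.
case: m => // m wm; rewrite wordmx_cons !ffunE mulmxDl.
rewrite {1}(IH m.+1 (leqW wm)) (IH m wm) !mulmx_sumr.
rewrite [RHS](eq_bigr (fun k : 'I_m.+2 => t ^+ k *: (X j *m wordjet X H k w)
  + t ^+ k *: (if val k is k'.+1 then H j *m wordjet X H k' w else 0))); last first.
  by move=> k _; rewrite scalerDr.
rewrite big_split /=; congr (_ + _).
  by apply: eq_bigr => k _; rewrite scalemxAr.
rewrite [RHS]big_ord_recl /= scaler0 add0r; apply: eq_bigr => k _.
by rewrite -scalemxAl -scalemxAr scalerA exprS.
Qed.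

(** The coefficient of t^k in p(X + tH), hence half of p''(X)[H] for [k = 2]. *)
Definition ncjet (p : ncpoly R g) n (X H : mxtuple R g n) k : 'M[R]_n :=
  \sum_(w : (ncdeg p).-bseq 'I_g) nccoef p w *: wordjet X H k w.

Lemma nceval_line p n (X H : mxtuple R g n) (t : R) m : (ncdeg p <= m)%N ->
  nceval p (X + t *: H) = \sum_(k < m.+1) t ^+ k *: ncjet p X H k.
Proof.
move=> dm; rewrite (nceval_words _ (leqnn _)).
under eq_bigr => w _ do
  rewrite (wordmx_line _ _ _ (leq_trans (size_bseq w) dm)) scaler_sumr.
rewrite exchange_big /=; apply: eq_bigr => k _.
rewrite /ncjet scaler_sumr; apply: eq_bigr => w _.
by rewrite !scalerA mulrC.
Qed.

Lemma wordjet_eq0 n (X H : mxtuple R g n) k w :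
  (size w < k)%N -> wordjet X H k w = 0.
Proof.
elim: w k => [|j w IH] [|k] //= wk; first by apply: raddf0.
by rewrite !IH ?mulmx0 ?addr0 //; apply: leqW.
Qed.

Lemma ncjet_eq0 p n (X H : mxtuple R g n) k :
  (ncdeg p < k)%N -> ncjet p X H k = 0.
Proof.
move=> dk; apply: big1 => w _; rewrite wordjet_eq0 ?scaler0 //.
exact: leq_ltn_trans (size_bseq w) dk.
Qed.

Lemma ncjet_dir0 p n (X : mxtuple R g n) k : ncjet p X 0 k.+1 = 0.
Proof.
apply: big1 => w _; suff -> : wordjet X 0 k.+1 w = 0 by rewrite scaler0.
elim: (w : seq _) => [|j u IH] /=; first by apply: raddf0.
by rewrite IH ffunE mulmx0 mul0mx addr0.
Qed.

(** The entries of p(X + tH) as formal polynomials in t, so that the analytic derivatives in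
    [ncder1] and [ncder2] reduce to coefficients. *)
Definition linepoly p n (X H : mxtuple R g n) i j : {poly R} :=
  \poly_(k < (ncdeg p).+1) ncjet p X H k i j.

Lemma coef_linepoly p n (X H : mxtuple R g n) i j k :
  (linepoly p X H i j)`_k = ncjet p X H k i j.
Proof.
by rewrite coef_poly; case: ltnP => // dk; rewrite ncjet_eq0 // mxE.
Qed.

Lemma horner_linepoly p n (X H : mxtuple R g n) i j t :
  (linepoly p X H i j).[t] = nceval p (X + t *: H) i j.
Proof.
rewrite (nceval_line _ _ _ (leqnn _)) horner_poly summxE; apply: eq_bigr => k _.
by rewrite mxE mulrC.
Qed.

Lemma ncder1E p n (X H : mxtuple R g n) : ncder1 p X H = ncjet p X H 1.
Proof.
apply/matrixP => i j; rewrite mxE.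
rewrite (_ : (fun t => _) = horner (linepoly p X H i j)); last first.
  by apply/funext => t; rewrite horner_linepoly.
by rewrite -derivE horner_coef0 coef_deriv coef_linepoly mulr1n.
Qed.

Lemma ncder2E p n (X H : mxtuple R g n) : ncder2 p X H = 2 *: ncjet p X H 2.
Proof.
apply/matrixP => i j; rewrite mxE.
rewrite (_ : (fun t => _) = horner (linepoly p X H i j)); last first.
  by apply/funext => t; rewrite horner_linepoly.
rewrite derive1nS derive1n1 -!derivE horner_coef0 !coef_deriv coef_linepoly.
by rewrite mxE mulr1n mulr_natl.
Qed.

End Words.

(** * The Hessian form *)

Section Hessian.
Variables (R : realType) (g : nat).

Lemma trmxZ m n (a : R) (A : 'M[R]_(m, n)) : (a *: A)^T = a *: A^T.
Proof. by apply/matrixP => i j; rewrite !mxE. Qed.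

(** The entries H_j b(X) v of the border vector in the middle matrix representation of the Hessian;
    the empty word gets the default 0. *)
Definition bordervec n (X H : mxtuple R g n) (v : 'cV[R]_n) (w : seq 'I_g) :
    'cV[R]_n :=
  if w is j :: b then H j *m (wordmx X b *m v) else 0.

Lemma wordjet1_mul n (X H : mxtuple R g n) v w :
  wordjet X H 1 w *m v =
  \sum_(i < size w) wordmx X (take i w) *m bordervec X H v (drop i w).
Proof.
elim: w => [|j w IH] /=; first by rewrite big_ord0 raddf0 mul0mx.
rewrite big_ord_recl /= wordmx_nil mul1mx mulmxDl wordjet0 mulmxA addrC.
congr (_ + _); rewrite -mulmxA IH mulmx_sumr; apply: eq_bigr => i _.
by rewrite wordmx_cons mulmxA.
Qed.

(** Here [i] is the position of the first replaced letter. The prefix up to and including it moves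
    to the left as a transpose and becomes the border vector of the reversed prefix, because [X] and
    [H] are symmetric. *)
Lemma wordjet2_mul n (X H : mxtuple R g n) (v : 'cV[R]_n) w :
    symtuple X -> symtuple H ->
  v^T *m wordjet X H 2 w *m v =
  \sum_(i < size w) (bordervec X H v (rev (take i.+1 w)))^T *m
     (wordjet X H 1 (drop i.+1 w) *m v).
Proof.
move=> Xs Hs.
(* The induction on [w] needs a prefix [u] of letters already passed. *)
suff jE u : wordmx X u *m wordjet X H 2 w =
    \sum_(i < size w) wordmx X (u ++ take i w) *m
      (if drop i w is j :: b then H j *m wordjet X H 1 b else 0).
  have := jE [::]; rewrite wordmx_nil mul1mx /= => ->.
  rewrite mulmx_sumr mulmx_suml; apply: eq_bigr => -[i iw] _ /=.
  have := size_drop i w; have := cat_take_drop i w.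
  case wE: (drop i w) => [|j b] wE' /=.
    by move=> /esym/eqP; rewrite subn_eq0 leqNgt iw.
  have ti : size (take i w) = i by rewrite size_takel // ltnW.
  have -> : drop i.+1 w = b.
    by rewrite -wE' drop_cat ti ltnNge leqnSn /= subSnn /= drop0.
  have -> : take i.+1 w = rcons (take i w) j.
    by rewrite -{1}wE' take_cat ti ltnNge leqnSn /= subSnn /= take0 cats1.
  rewrite rev_rcons /= !trmx_mul (wordmx_rev _ Xs) trmxK Hs !mulmxA.
  by [].
elim: w u => [|j w IH] u /=.
  by rewrite big_ord0 raddf0 mulmx0.
rewrite big_ord_recl /= cats0 mulmxDr addrC; congr (_ + _).
have -> : wordmx X u *m (X j *m wordjet X H 2 w) =
    wordmx X (rcons u j) *m wordjet X H 2 w.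
  by rewrite -cats1 wordmx_cat wordmx_cons wordmx_nil mulmx1 mulmxA.
rewrite IH; apply: eq_bigr => i _.
by rewrite -cats1 -catA.
Qed.

(* The unipotent change of variables that makes the coefficients of the Hessian
   form independent of [X]. *)
Definition zvec (c : nat -> R) n (X : mxtuple R g n) (y : seq 'I_g -> 'cV[R]_n)
    (w : seq 'I_g) : 'cV[R]_n :=
  \sum_(l < (size w).-1.+1) c l *: (wordmx X (take l w) *m y (drop l w)).

Section SquareRoot.
Variables (c : nat -> R) (n : nat) (X : mxtuple R g n) (y : seq 'I_g -> 'cV[R]_n).
Hypothesis Xs : symtuple X.

(** The term of the factorization of [w] as u^T m w' in which u^T has length [i] and u^T m has
    length [j]. *)
Let T (w : seq 'I_g) i j : 'M[R]_1 := (y (rev (take i w)))^T *m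
  (wordmx X (take (j - i) (drop i w)) *m y (drop j w)).

Lemma zvec_drop w k : (0 < k < size w)%N ->
  zvec c X y (drop k w) = \sum_(1 <= j < size w | (k <= j)%N)
     c (j - k)%N *: (wordmx X (take (j - k) (drop k w)) *m y (drop j w)).
Proof.
move=> /andP[k0 kw].
rewrite -(big_nat_widenl _ _ _ xpredT) //.
rewrite -[X in index_iota X]add0n big_addn big_mkord /zvec.
rewrite size_drop prednK ?subn_gt0 //; apply: eq_bigr => l _.
by rewrite addnK drop_drop.
Qed.

Lemma zvec_rev_take w k : (0 < k < size w)%N ->
  zvec c X y (rev (take k w)) = \sum_(1 <= i < size w | (i <= k)%N)
     c (k - i)%N *: ((wordmx X (take (k - i) (drop i w)))^T *m y (rev (take i w))).
Proof.
move=> /andP[k0 kw]; rewrite -(big_nat_widen _ _ _ xpredT _ kw).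
rewrite big_add1 /= big_mkord /zvec size_rev size_takel ?(ltnW kw) // prednK //.
rewrite (reindex_inj rev_ord_inj) /=; apply: eq_bigr => l _.
have lk := ltn_ord l.
have tk : size (take k w) = k by rewrite size_takel // ltnW.
have -> : wordmx X (take (k - l.+1) (rev (take k w))) =
    (wordmx X (take (k - l.+1) (drop l.+1 w)))^T.
  rewrite take_rev tk subKn // -(wordmx_rev _ Xs); congr (wordmx X (rev _)).
  by rewrite take_drop subnK.
by rewrite drop_rev tk subKn // take_takel.
Qed.

(** Expanding both factors of the cut at [k] gives terms [T w i j] with [i <= k <= j] and weight
    [c (k - i) * c (j - k)]. Summed over [k], the weights give the coefficient of t^(j - i) in the
    square of (1 - t)^(-1/2), which is 1. *)
Lemma sum_zvec_word w m : (size w <= m)%N ->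
    (forall k, (k <= m)%N -> \sum_(i < k.+1) c i * c (k - i)%N = 1) ->
  \sum_(1 <= k < size w)
     (zvec c X y (rev (take k w)))^T *m zvec c X y (drop k w) =
  \sum_(1 <= i < size w) \sum_(1 <= j < size w | (i <= j)%N) T w i j.
Proof.
move=> wm c1.
transitivity (\sum_(1 <= k < size w) \sum_(1 <= i < size w | (i <= k)%N)
   \sum_(1 <= j < size w | (k <= j)%N) (c (k - i)%N * c (j - k)%N) *: T w i j).
  apply: eq_big_nat => k kw; rewrite zvec_drop // zvec_rev_take //.
  rewrite [X in X *m _](linear_sum (@trmx R n 1)) mulmx_suml.
  rewrite big_nat_cond [RHS]big_nat_cond.
  apply: eq_bigr => i /andP[/andP[i1 iw] ik].
  rewrite mulmx_sumr /= big_nat_cond [RHS]big_nat_cond.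
  apply: eq_bigr => j /andP[/andP[j1 jw] kj].
  rewrite trmxZ -scalemxAl -scalemxAr scalerA /T; congr (_ *: _).
  rewrite trmx_mul trmxK -!mulmxA; congr (_ *m _).
  rewrite !mulmxA -wordmx_cat; congr (wordmx X _ *m _).
  have <- : ((k - i) + (j - k))%N = (j - i)%N.
    by rewrite addnC addnBA // subnK.
  by rewrite takeD drop_drop subnK.
under eq_bigr => k _ do rewrite big_mkcond.
rewrite exchange_big /=; apply: eq_big_nat => i /andP[i1 iw].
under eq_bigr => k _ do rewrite (fun_if (fun a => a)) big_mkcond.
transitivity (\sum_(1 <= k < size w) \sum_(1 <= j < size w)
   if (i <= k <= j)%N then (c (k - i)%N * c (j - k)%N) *: T w i j else 0).
  apply: eq_bigr => k _; case: ifP => ik /=; first by [].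
  by rewrite big1.
rewrite exchange_big /= [RHS]big_mkcond; apply: eq_big_nat => j /andP[j1 jw].
rewrite -big_mkcond /=; case: ifP => ij; last first.
  by rewrite big1 // => k /andP[ik kj]; rewrite (leq_trans ik kj) in ij.
rewrite -scaler_suml (_ : (\sum_(_ <= _ < _ | _) _) = 1) ?scale1r //.
rewrite -(c1 (j - i)%N); last first.
  by rewrite (leq_trans (leq_subr _ _)) // (leq_trans (ltnW jw)).
transitivity (\sum_(i <= k < j.+1) c (k - i)%N * c (j - k)%N).
  by rewrite [RHS](big_nat_widenl i 1) // (big_nat_widen 1 j.+1 (size w)) //.
rewrite -[X in index_iota X]add0n big_addn big_mkord subSn //; apply: eq_bigr => k _.
by rewrite addnK subnDA subnAC.
Qed.

End SquareRoot.

Lemma wordjet2_sum n (X H : mxtuple R g n) (v : 'cV[R]_n) w :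
    symtuple X -> symtuple H ->
  v^T *m wordjet X H 2 w *m v =
  \sum_(1 <= i < size w) \sum_(1 <= j < size w | (i <= j)%N)
    (bordervec X H v (rev (take i w)))^T *m
    (wordmx X (take (j - i) (drop i w)) *m bordervec X H v (drop j w)).
Proof.
move=> Xs Hs; rewrite wordjet2_mul //.
pose F i := (bordervec X H v (rev (take i w)))^T *m
  (wordjet X H 1 (drop i w) *m v).
transitivity (\sum_(1 <= i < (size w).+1) F i).
  by rewrite big_add1 /= big_mkord.
have [->|w0] := eqVneq (size w) 0%N; first by rewrite !big_geq.
rewrite big_nat_recr ?lt0n //= [X in _ + X](_ : _ = 0) ?addr0; last first.
  by rewrite /F drop_size wordjet1_mul /= big_ord0 mulmx0.
apply: eq_big_nat => i /andP[i1 iw]; rewrite /F wordjet1_mul mulmx_sumr.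
rewrite -(big_nat_widenl _ _ _ xpredT) //.
rewrite -[X in index_iota X]add0n big_addn big_mkord size_drop.
by apply: eq_bigr => k _; rewrite addnK drop_drop.
Qed.

(** Nonempty words of length at most [m.+1], coded as a first letter and a tail to form a finite
    type. With [m = d.-2] and d at least 2 these are the lengths 1 to d - 1; for smaller d truncated
    subtraction leaves the single letters. *)
Definition letword m := ('I_g * m.-bseq 'I_g)%type.
Definition wd m (a : letword m) : seq 'I_g := a.1 :: a.2.

Lemma wd_inj m : injective (@wd m).
Proof. by move=> [i u] [j w] [-> uw]; congr (_, _); apply: val_inj. Qed.

Lemma wd_surj m w : (0 < size w <= m.+1)%N -> exists a : letword m, wd a = w.
Proof. by case: w => // i w wm; exists (i, Bseq (wm : (size w <= m)%N)). Qed.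

Lemma size_wd m (a : letword m) : (0 < size (wd a) <= m.+1)%N.
Proof. by rewrite /= ltnS size_bseq. Qed.

(** A word cut strictly inside corresponds to a pair of nonempty words, the left part being
    reversed. Pairs whose concatenation is longer than the degree have coefficient 0. *)
Lemma sum_split_words (V : lmodType R) (p : ncpoly R g)
    (B : seq 'I_g -> seq 'I_g -> V) :
  \sum_(w : (ncdeg p).-bseq 'I_g) nccoef p w *:
    \sum_(1 <= k < size w) B (rev (take k w)) (drop k w) =
  \sum_(a : letword (ncdeg p).-2) \sum_(b : letword (ncdeg p).-2)
    nccoef p (rev (wd a) ++ wd b) *: B (wd a) (wd b).
Proof.
set d := ncdeg p.
(* The graph of this correspondence: the left side is first rewritten as a sum over all
   [(w, k, a, b)] in it. *)
pose P (w : d.-bseq 'I_g) (k : 'I_d.+1) (a b : letword d.-2) :=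
  [&& (0 < k < size w)%N, wd a == rev (take k w) & wd b == drop k w].
transitivity (\sum_(w : d.-bseq 'I_g) \sum_(k < d.+1) \sum_a \sum_b
    if P w k a b then nccoef p w *: B (wd a) (wd b) else 0).
  apply: eq_bigr => w _; rewrite scaler_sumr.
  have wd1 : (size w <= d.+1)%N by apply: leqW; apply: size_bseq.
  rewrite (big_nat_widen _ _ _ xpredT _ wd1) (big_nat_widenl _ 0) //= big_mkord.
  rewrite big_mkcond; apply: eq_bigr => k _.
  rewrite andbC /P; case: ifP => kw /=; last first.
    by rewrite big1 // => a _; rewrite big1.
  have [k0 kw'] := andP kw; have sw := size_bseq w.
  have kd : (k < d)%N := leq_trans kw' sw.
  have aux x : (x < d)%N -> (x <= d.-2.+1)%N by case: (d) => [|[/ltnW|e]].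
  have [a aE] : exists a : letword d.-2, wd a = rev (take k w).
    apply: wd_surj; rewrite size_rev size_takel ?(ltnW kw') // k0.
    exact: aux kd.
  have [b bE] : exists b : letword d.-2, wd b = drop k w.
    apply: wd_surj; rewrite size_drop subn_gt0 kw' /=.
    by apply: aux; apply: leq_trans sw; rewrite ltn_subrL k0 (leq_trans _ kw').
  rewrite (bigD1 a) //= [X in _ + X]big1 ?addr0; last first.
    move=> a' a'a; rewrite big1 // => b' _.
    by rewrite -aE (inj_eq (@wd_inj _)) (negPf a'a).
  rewrite (bigD1 b) //= [X in _ + X]big1 ?addr0; last first.
    by move=> b' b'b; rewrite -bE (inj_eq (@wd_inj _)) (negPf b'b) andbF.
  by rewrite aE bE !eqxx.
under eq_bigr => w _ do rewrite exchange_big /=.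
rewrite exchange_big; apply: eq_bigr => a _ /=.
under eq_bigr => w _ do rewrite exchange_big /=.
rewrite exchange_big; apply: eq_bigr => b _ /=.
have PE w k : P w k a b -> w = rev (wd a) ++ wd b :> seq _ /\ k = size (wd a) :> nat.
  case/and3P=> /andP[k0 kw] /eqP aE /eqP ->; rewrite aE revK cat_take_drop.
  by rewrite size_rev size_takel // ltnW.
have [sab|sab] := leqP (size (rev (wd a) ++ wd b)) d; last first.
  rewrite (nccoef_eq0 sab) scale0r big1 // => w _; rewrite big1 // => k _.
  case: ifP => // /PE[wE _]; have := size_bseq w.
  by rewrite wE leqNgt sab.
have ka : (size (wd a) < d.+1)%N.
  by rewrite ltnS (leq_trans _ sab) // size_cat size_rev leq_addr.
rewrite (bigD1 (Bseq sab)) //= [X in _ + X]big1 ?addr0; last first.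
  move=> w wn; rewrite big1 // => k _; case: ifP => // /PE[wE _].
  by case/eqP: wn; apply: val_inj.
rewrite (bigD1 (Ordinal ka)) //= [X in _ + X]big1 ?addr0; last first.
  move=> k kn; case: ifP => // /PE[_ kE].
  by case/eqP: kn; apply: val_inj.
rewrite ifT // /P; have sr : size (rev (wd a)) = (size (wd a)) by rewrite size_rev.
apply/and3P; split.
- change ((0 < size (wd a) < size (rev (wd a) ++ wd b))%N).
  apply/andP; split=> //.
  by rewrite size_cat sr -[X in (X < _)%N]addn0 ltn_add2l.
- change (wd a == rev (take (size (wd a)) (rev (wd a) ++ wd b))).
  by rewrite -sr take_size_cat // revK.
- change (wd b == drop (size (wd a)) (rev (wd a) ++ wd b)).
  by rewrite -sr drop_size_cat.
Qed.

(** The sum over pairs of replaced letters becomes a sum over cuts of the z-vectors, so that [X] no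
    longer enters the coefficients. *)
Lemma ncjet2_form (p : ncpoly R g) (c : nat -> R) n (X H : mxtuple R g n)
    (v : 'cV[R]_n) :
    symtuple X -> symtuple H ->
    (forall k, (k <= ncdeg p)%N -> \sum_(i < k.+1) c i * c (k - i)%N = 1) ->
  v^T *m ncjet p X H 2 *m v =
  \sum_(a : letword (ncdeg p).-2) \sum_(b : letword (ncdeg p).-2)
    nccoef p (rev (wd a) ++ wd b) *:
      ((zvec c X (bordervec X H v) (wd a))^T *m
        zvec c X (bordervec X H v) (wd b)).
Proof.
move=> Xs Hs c1; rewrite mulmx_sumr mulmx_suml.
rewrite -(@sum_split_words _ p (fun u w => (zvec c X (bordervec X H v) u)^T *m
        zvec c X (bordervec X H v) w)).
apply: eq_bigr => w _; rewrite -scalemxAr -scalemxAl; congr (_ *: _).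
by rewrite (sum_zvec_word _ Xs (size_bseq w)) // wordjet2_sum.
Qed.

End Hessian.

(** * The constant Hankel matrix and the upper bound for the signature *)

Section UpperBound.
Variables (R : realType) (g : nat).

Lemma bordervec_linear n (X : mxtuple R g n) (v : 'cV[R]_n) a H K w :
  bordervec X (a *: H + K) v w = a *: bordervec X H v w + bordervec X K v w.
Proof.
case: w => [|j w] /=; first by rewrite scaler0 addr0.
by rewrite !ffunE mulmxDl scalemxAl.
Qed.

Lemma zvec_linear (c : nat -> R) n (X : mxtuple R g n) a y y' w :
  zvec c X (fun u => a *: y u + y' u) w = a *: zvec c X y w + zvec c X y' w.
Proof.
rewrite /zvec scaler_sumr -big_split /=; apply: eq_bigr => l _.
by rewrite mulmxDr scalerDr -scalemxAr !scalerA mulrC.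
Qed.

(** The vector [zvec c X y w] involves [y] only at nonempty suffixes of [w], so the values of [y] on
    longer words do not affect it. *)
Lemma eq_zvec (c : nat -> R) n (X : mxtuple R g n) y y' w :
  (forall u, (size u <= size w)%N -> (0 < size w)%N -> (0 < size u)%N ->
     y u = y' u) ->
  (0 < size w)%N -> zvec c X y w = zvec c X y' w.
Proof.
move=> yy w0; apply: eq_bigr => l _; congr (_ *: (_ *m _)); apply: yy => //.
  by rewrite size_drop leq_subr.
by rewrite size_drop subn_gt0 -{2}(prednK w0) ltn_ord.
Qed.

Definition wordmat m n (f : seq 'I_g -> 'cV[R]_n) : 'M[R]_(#|{: letword g m}|, n) :=
  \matrix_(i, j) f (wd (enum_val i)) j 0.

Lemma wordmat_linear m n (f f' : seq 'I_g -> 'cV[R]_n) a :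
  wordmat m (fun w => a *: f w + f' w) = a *: wordmat m f + wordmat m f'.
Proof. by apply/matrixP => i j; rewrite !mxE. Qed.

(** Half the middle matrix of the Hessian at X = 0. *)
Definition hankel (p : ncpoly R g) : 'M[R]_#|{: letword g (ncdeg p).-2}| :=
  \matrix_(i, j) nccoef p (rev (wd (enum_val i)) ++ wd (enum_val j)).

Lemma tr_hankel p : nc_symmetric p -> (hankel p)^T = hankel p.
Proof.
move=> ps; apply/matrixP => i j; rewrite !mxE -[LHS](nccoef_rev _ ps).
by rewrite rev_cat revK.
Qed.

Variables (p : ncpoly R g) (c : nat -> R).
Let N := #|{: letword g (ncdeg p).-2}|.
Variables (Q : 'M[R]_N) (D : 'rV[R]_N).
Hypothesis c1 : forall k, (k <= ncdeg p)%N ->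
  \sum_(i < k.+1) c i * c (k - i)%N = 1.
Hypothesis hankelE : hankel p = Q *m diag_mx D *m Q^T.

(** Coordinates, linear in [H], in which the Hessian form is diagonal: row k carries the weight
    [D 0 k], up to the common factor 2. *)
Definition hessmat n (X H : mxtuple R g n) (v : 'cV[R]_n) : 'M[R]_(N, n) :=
  Q^T *m wordmat (ncdeg p).-2 (zvec c X (bordervec X H v)).

Lemma hessmat_linear n (X : mxtuple R g n) (v : 'cV[R]_n) a H K :
  hessmat X (a *: H + K) v = a *: hessmat X H v + hessmat X K v.
Proof.
rewrite /hessmat scalemxAr -mulmxDr -wordmat_linear; congr (_ *m wordmat _ _).
apply/funext => w; rewrite -zvec_linear; congr (zvec c X _ w).
by apply/funext => u; exact: bordervec_linear.
Qed.

Lemma qform_ncder2 n (X H : mxtuple R g n) (v : 'cV[R]_n) :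
    symtuple X -> symtuple H ->
  qform (ncder2 p X H) v =
  2 * \sum_k D 0 k * \sum_j (hessmat X H v k j) ^+ 2.
Proof.
move=> Xs Hs; rewrite /qform ncder2E -scalemxAr -scalemxAl mxE.
rewrite -trace_congr_diag -hankelE trace_quadratic.
rewrite (ncjet2_form _ Xs Hs c1) summxE; congr (_ * _).
rewrite (reindex _ (onW_bij _ (enum_val_bij _))) /=; apply: eq_bigr => i _.
rewrite summxE (reindex _ (onW_bij _ (enum_val_bij _))) /=.
apply: eq_bigr => j _; rewrite [LHS]mxE [hankel _ _ _]mxE; congr (_ * (_ *m _) 0 0).
  by apply/rowP => k; rewrite !mxE.
by apply/colP => k; rewrite !mxE.
Qed.

Lemma signature_ge s n (X : mxtuple R g n) (v : 'cV[R]_n) U :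
  signed_subspace s p X v U -> (\dim U <= signature s p X v)%N.
Proof.
move=> sU; have dU : (\dim U < (\dim {: mxtuple R g n}).+1)%N.
  by rewrite ltnS dimvS ?subvf.
apply: (@leq_bigmax_cond _ _ (fun k : 'I_(_.+1) => k : nat) (Ordinal dU)).
by apply/asboolP; exists U.
Qed.

Lemma signature_le s n (X : mxtuple R g n) (v : 'cV[R]_n) b :
  (forall U, signed_subspace s p X v U -> (\dim U <= b)%N) ->
  (signature s p X v <= b)%N.
Proof.
by move=> h; apply/bigmax_leqP => k /asboolP[U sU <-]; exact: h.
Qed.

(** The default value 0 of an empty maximum is realized by the zero subspace. *)
Lemma signature_witness s n (X : mxtuple R g n) (v : 'cV[R]_n) :
  exists2 U, signed_subspace s p X v U & \dim U = signature s p X v.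
Proof.
rewrite /signature; elim/big_ind: _ => [|x y [U sU dU] [V sV dV]|k /asboolP//].
  exists 0%VS; last by rewrite dimv0.
  move=> H; rewrite memv0 => /eqP ->; rewrite eqxx; split=> //.
    by move=> i; rewrite ffunE trmx0.
  by rewrite ncder1E ncjet_dir0 mul0mx.
by case: (leqP x y) => _; [exists V|exists U].
Qed.

(** The rows of [hessmat] whose weight has sign [s] determine [H] within [U], since the signed form
    is nonpositive where they vanish. They range in a space of dimension [inertia s D * n]. *)
Lemma signature_le_inertia s n (X : mxtuple R g n) (v : 'cV[R]_n) :
  symtuple X -> (signature s p X v <= inertia s D * n)%N.
Proof.
move=> Xs; apply: signature_le => U sU.
pose f H : 'M[R]_(inertia s D, n) :=
  \matrix_(k < inertia s D, j < n) hessmat X H v (enum_val k) j.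
have lf : linear f.
  move=> a H K; rewrite /f hessmat_linear.
  by apply/matrixP => k j; rewrite !mxE.
rewrite -(dimv_mx R); apply: (dimv_le_of_inj lf) => H HU fH.
have [Hs _ pos] := sU H HU; apply/eqP/negPn/negP => /pos.
rewrite (qform_ncder2 _ Xs Hs) mulrCA pmulr_rgt0 // ltNge => /negP; apply.
apply: signed_sum_le0 => [k|k Dk].
  by apply: sumr_ge0 => j _; exact: sqr_ge0.
apply: big1 => j _.
have := congr1 (fun A : 'M[R]_(_, n) => A (enum_rank_in Dk k) j) fH.
by rewrite [LHS]mxE [RHS]mxE enum_rankK_in // => ->; rewrite expr0n.
Qed.

End UpperBound.

(** * Lower bound for the signature *)

Section LowerBound.
Variables (R : realType) (g : nat).

Definition vecmat m n (X : mxtuple R g n) (v : 'cV[R]_n) :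
    'M[R]_(#|{: m.-bseq 'I_g}|, n) :=
  \matrix_(i, j) (wordmx X (enum_val i : m.-bseq 'I_g) *m v) j 0.

Definition words_free m n (X : mxtuple R g n) (v : 'cV[R]_n) : Prop :=
  row_free (vecmat m X v).

(** The rows of [y] are freely chosen values on the words coded by [letword]; the default 0 covers
    all other words, the empty one included. *)
Definition wordext m n (y : 'M[R]_(#|{: letword g m}|, n)) (w : seq 'I_g) :
    'cV[R]_n :=
  if [pick a : letword g m | wd a == w] is Some a
  then (row (enum_rank a) y)^T else 0.

Lemma wordext_wd m n (y : 'M[R]_(#|{: letword g m}|, n)) a :
  wordext y (wd a) = (row (enum_rank a) y)^T.
Proof.
rewrite /wordext; case: pickP => [b /eqP/wd_inj -> //|/(_ a)].
by rewrite eqxx.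
Qed.

Lemma wordext_linear m n a (y y' : 'M[R]_(#|{: letword g m}|, n)) w :
  wordext (a *: y + y') w = a *: wordext y w + wordext y' w.
Proof.
rewrite /wordext; case: pickP => [b _|_]; last by rewrite scaler0 addr0.
by apply/colP => i; rewrite !mxE.
Qed.

Lemma wordext_inj m n (y : 'M[R]_(#|{: letword g m}|, n)) :
  (forall a : letword g m, wordext y (wd a) = 0) -> y = 0.
Proof.
move=> y0; apply/matrixP => i j.
have := y0 (enum_val i); rewrite wordext_wd enum_valK.
by move=> /colP/(_ j); rewrite !mxE.
Qed.

(** Since [c 0 = 1], the z-vector of a word is its y-vector plus contributions of strictly shorter
    suffixes, so [y] is recovered by induction on the length. *)
Lemma zvec_inj (c : nat -> R) m n (X : mxtuple R g n)
    (y : 'M[R]_(#|{: letword g m}|, n)) :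
  c 0%N = 1 -> (forall a : letword g m, zvec c X (wordext y) (wd a) = 0) -> y = 0.
Proof.
move=> c0 z0; apply: wordext_inj.
suff h k w : (size w <= k)%N -> (0 < size w <= m.+1)%N -> wordext y w = 0.
  by move=> a; apply: (h (size (wd a))) => //; exact: size_wd.
elim: k w => [|k IH] w wk wm; first by case: w wk wm.
have [a aE] := wd_surj wm.
have := z0 a; rewrite aE /zvec big_ord_recl take0 drop0 wordmx_nil mul1mx c0.
rewrite scale1r big1 ?addr0 // => i _.
have [w0 wm'] := andP wm.
rewrite IH ?mulmx0 ?scaler0 // size_drop lift0.
  by rewrite leq_subLR addSn (leq_trans wk) // ltnS leq_addl.
by rewrite subn_gt0 -ltn_predRL ltn_ord (leq_trans (leq_subr _ _)).
Qed.

Lemma ffun_linE (I : finType) (U : lmodType R) a (f h : {ffun I -> U}) i :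
  (a *: f + h) i = a *: f i + h i.
Proof. by rewrite !ffunE. Qed.

(* Given that [L *m V = 1], a symmetric [A] with [A *m V = Y]. *)
Definition sym_interp n k (V : 'M[R]_(n, k)) (L : 'M[R]_(k, n))
    (Y : 'M[R]_(n, k)) : 'M[R]_n :=
  Y *m L + (Y *m L)^T - L^T *m (V^T *m Y) *m L.

(** The correction term cancels [(Y *m L)^T *m V] exactly because [V^T *m Y] is symmetric. That
    condition is also necessary: it says that [V^T *m A *m V] is symmetric. *)
Lemma sym_interpP n k (V Y : 'M[R]_(n, k)) (L : 'M[R]_(k, n)) :
    L *m V = 1%:M -> (V^T *m Y)^T = V^T *m Y ->
  (sym_interp V L Y)^T = sym_interp V L Y /\ sym_interp V L Y *m V = Y.
Proof.
move=> LV VY; split; rewrite /sym_interp.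
  rewrite linearB linearD /= trmxK [(Y *m L)^T + _]addrC; congr (_ - _).
  by rewrite trmx_mul [(L^T *m _)^T]trmx_mul VY trmxK mulmxA.
rewrite mulmxBl mulmxDl -!mulmxA LV !mulmx1 trmx_mul -mulmxA.
have -> : Y^T *m V = V^T *m Y by rewrite -VY trmx_mul trmxK.
by rewrite addrK.
Qed.

Lemma sym_interp_linear n k (V : 'M[R]_(n, k)) (L : 'M[R]_(k, n)) :
  forall a Y Y',
  sym_interp V L (a *: Y + Y') = a *: sym_interp V L Y + sym_interp V L Y'.
Proof.
move=> a Y Y'; rewrite /sym_interp.
have -> : (a *: Y + Y') *m L = a *: (Y *m L) + Y' *m L.
  by rewrite mulmxDl -scalemxAl.
have -> : L^T *m (V^T *m (a *: Y + Y')) *m L =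
    a *: (L^T *m (V^T *m Y) *m L) + L^T *m (V^T *m Y') *m L.
  by rewrite 2!mulmxDr mulmxDl -2!scalemxAr -scalemxAl.
move: (Y *m L) (Y' *m L) (L^T *m _ *m L) (L^T *m _ *m L) => P P' S S'.
by apply/matrixP => i j; rewrite !mxE; ring.
Qed.

(** The map [f] measures the failure of symmetry of [V^T *m Y]. Its values are tuples of [k] by [k]
    matrices, so the number of constraints does not depend on [n]. *)
Lemma sym_tuple_interp (I : finType) (U : vectType R) n k (V : 'M[R]_(n, k))
    (L : 'M[R]_(k, n)) (Y : U -> I -> 'M[R]_(n, k)) :
    L *m V = 1%:M ->
    (forall a y y' j, Y (a *: y + y') j = a *: Y y j + Y y' j) ->
  exists h : U -> {ffun I -> 'M[R]_n}, exists2 f : U -> {ffun I -> 'M[R]_k},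
    linear h /\ linear f &
    forall y, f y = 0 -> forall j, (h y j)^T = h y j /\ h y j *m V = Y y j.
Proof.
move=> LV Ylin.
exists (fun y => [ffun j => sym_interp V L (Y y j)]).
exists (fun y => [ffun j => V^T *m Y y j - (V^T *m Y y j)^T]).
  split=> a y y'; apply/ffunP => j; rewrite ffun_linE !ffunE Ylin.
    exact: sym_interp_linear.
  rewrite mulmxDr -scalemxAr.
  move: (V^T *m Y y j) (V^T *m Y y' j) => P P'.
  by apply/matrixP => i i'; rewrite !mxE; ring.
move=> y /ffunP y0 j; rewrite ffunE; apply: sym_interpP => //.
by have := y0 j; rewrite !ffunE => /eqP; rewrite subr_eq0 eq_sym => /eqP.
Qed.

Section Curvature.
Variables (p : ncpoly R g) (c : nat -> R).
Let d := ncdeg p.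
Let m := d.-2.
Let N := #|{: letword g m}|.
Variables (Q : 'M[R]_N) (D : 'rV[R]_N).
Hypothesis d2 : (1 < d)%N.
Hypothesis c0 : c 0%N = 1.
Hypothesis c1 : forall k, (k <= ncdeg p)%N ->
  \sum_(i < k.+1) c i * c (k - i)%N = 1.
Hypothesis Qu : Q \in unitmx.
Hypothesis hankelE : hankel p = Q *m diag_mx D *m Q^T.

Variables (n : nat) (X : mxtuple R g n) (v : 'cV[R]_n).
Hypothesis Xs : symtuple X.
Variable W : seq 'I_g.
Hypotheses (Wd : size W = d) (W0 : nccoef p W != 0).

(** When [f] is the border vector of [H], this is p'(X)[H] v. *)
Let word_pairing (f : seq 'I_g -> 'cV[R]_n) : 'cV[R]_n :=
  \sum_(w : d.-bseq 'I_g) nccoef p w *: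
    \sum_(i < size w) wordmx X (take i w) *m f (drop i w).

Let word_pairing_linear a f f' :
  word_pairing (fun w => a *: f w + f' w) =
  a *: word_pairing f + word_pairing f'.
Proof.
rewrite /word_pairing scaler_sumr -big_split /=; apply: eq_bigr => w _.
rewrite scalerA mulrC -scalerA -scalerDr; congr (_ *: _).
rewrite scaler_sumr -big_split /=; apply: eq_bigr => i _.
by rewrite mulmxDr scalemxAr.
Qed.

(* The value on the single word [W] of maximal length makes [p'(X)[H] v]
   vanish. *)
Let top_value (y : 'M[R]_(N, n)) : 'cV[R]_n :=
  - (nccoef p W)^-1 *: word_pairing (wordext y).

Let topext (y : 'M[R]_(N, n)) (w : seq 'I_g) : 'cV[R]_n :=
  wordext y w + (w == W)%:R *: top_value y.

Let topext_linear a y y' w :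
  topext (a *: y + y') w = a *: topext y w + topext y' w.
Proof.
rewrite /topext wordext_linear /top_value.
have -> : word_pairing (wordext (a *: y + y')) =
    a *: word_pairing (wordext y) + word_pairing (wordext y').
  rewrite -word_pairing_linear; congr word_pairing.
  by apply/funext => u; exact: wordext_linear.
rewrite !scalerDr !scalerA [RHS]addrACA; congr (_ + _ + (_ *: _ + _)).
by rewrite mulrC mulrA.
Qed.

(** The only word of length at most d with [W] as a suffix is [W] itself, so the top value enters
    with the sole factor [nccoef p W] and cancels the rest. *)
Let word_pairing_top y : word_pairing (topext y) = 0.
Proof.
have -> : topext y = (fun w => 1 *: wordext y w + (w == W)%:R *: top_value y).
  by apply/funext => w; rewrite scale1r.
rewrite word_pairing_linear scale1r.
have dW : (size W <= d)%N by rewrite Wd.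
rewrite {2}/word_pairing (bigD1 (Bseq dW)) //= [X in _ + (_ + X)]big1.
  have W1 : (0 < size W)%N by rewrite Wd ltnW.
  rewrite (bigD1 (Ordinal W1)) //= [X in _ + (_ *: (_ + X) + _)]big1.
    rewrite !addr0 take0 drop0 eqxx scale1r wordmx_nil mul1mx /top_value.
    by rewrite scalerA mulrN mulfV // scaleN1r subrr.
  move=> i i0; rewrite (_ : (_ == W) = false) ?scale0r ?mulmx0 //.
  apply/eqP => /(congr1 size); rewrite size_drop.
  have : (0 < i)%N by rewrite lt0n; apply: contra i0 => i0; exact/eqP/val_inj/eqP.
  by move=> i1 /eqP; rewrite ltn_eqF // ltn_subrL i1 W1.
move=> w wW; rewrite big1 ?scaler0 // => i _.
case: eqP => [dw|_]; last by rewrite scale0r mulmx0.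
case/eqP: wW; apply/val_inj => /=.
have : size (drop i w) = d by rewrite dw.
rewrite size_drop; have := size_bseq w; have := ltn_ord i.
case: (posnP i) => [i0 _ _ _|i1 iw wd' e]; first by rewrite -dw i0 drop0.
by exfalso; move: i1 iw wd' e; rewrite -/d; clear; lia.
Qed.

Let topext_short y w : (size w < d)%N -> topext y w = wordext y w.
Proof.
move=> wd'; rewrite /topext (_ : (w == W) = false) ?scale0r ?addr0 //.
by apply/eqP => wW; rewrite wW Wd ltnn in wd'.
Qed.

Variable B : 'M[R]_(n, #|{: d.-1.-bseq 'I_g}|).
Hypothesis VB : vecmat d.-1 X v *m B = 1%:M.

(** Column [b] is the value wanted for H_j b(X) v, which makes H_j the unknown of an interpolation
    problem at the vectors b(X) v. *)
Let topmat (y : 'M[R]_(N, n)) (j : 'I_g) : 'M[R]_(n, #|{: d.-1.-bseq 'I_g}|) :=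
  \matrix_(i, b) topext y (j :: (enum_val b : d.-1.-bseq 'I_g)) i 0.

Let topmat_linear a y y' j :
  topmat (a *: y + y') j = a *: topmat y j + topmat y' j.
Proof.
apply/matrixP => i b; rewrite [LHS]mxE topext_linear [LHS]mxE [RHS]mxE.
congr (_ + _); last by rewrite [RHS]mxE.
by rewrite [LHS]mxE [RHS]mxE; congr (_ * _); rewrite [RHS]mxE.
Qed.

Let V := (vecmat d.-1 X v)^T.

(** Independence of the vectors b(X) v gives [V] the left inverse [B^T]. Where the symmetry defect
    vanishes, the prescribed values are therefore border vectors of a symmetric tuple. *)
Let topmat_interp : exists direction : 'M[R]_(N, n) -> mxtuple R g n,
    exists2 defect : 'M[R]_(N, n) -> {ffun 'I_g -> 'M[R]_#|{: d.-1.-bseq 'I_g}|},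
    linear direction /\ linear defect &
    forall y, defect y = 0 -> symtuple (direction y) /\
    forall w, (0 < size w <= d)%N -> bordervec X (direction y) v w = topext y w.
Proof.
have LV : B^T *m V = 1%:M by rewrite -trmx_mul VB trmx1.
have [h [f lin hP]] := sym_tuple_interp LV topmat_linear.
exists h, f => // y /hP{}hP; split=> [j|[//|j w] /= wd']; first by case: (hP j).
have wd1 : (size w <= d.-1)%N by rewrite -ltnS prednK // ltnW.
have [_ /matrixP e] := hP j.
apply/colP => i; have := e i (enum_rank (Bseq wd1)).
rewrite [topmat _ _ _ _]mxE enum_rankK => <-.
rewrite [LHS]mxE [RHS]mxE; apply: eq_bigr => k _; congr (_ * _).
by rewrite [V _ _]mxE [RHS]mxE enum_rankK.
Qed.

(** A dimension count on the parameters [y]. Killing the coordinates that are not of sign [s] costs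
    [#|[predC A]| * n] conditions, and the symmetry defect at most the constant on the right. What
    remains maps injectively to directions on which the signed form is positive. *)
Lemma signature_ge_inertia_aux s :
  (inertia s D * n <= signature s p X v + g * (#|{: d.-1.-bseq 'I_g}| ^ 2))%N.
Proof.
set A := [pred k | 0 < (-1) ^+ s * D 0 k].
pose rest (y : 'M[R]_(N, n)) : 'M[R]_(#|[predC A]|, n) :=
  \matrix_(k < #|[predC A]|, j < n)
    (Q^T *m wordmat m (zvec c X (wordext y))) (enum_val k) j.
have rest_lin : linear rest.
  move=> a y y'; rewrite /rest.
  have -> : wordmat m (zvec c X (wordext (a *: y + y'))) =
      a *: wordmat m (zvec c X (wordext y)) + wordmat m (zvec c X (wordext y')).
    rewrite -wordmat_linear; congr wordmat; apply/funext => w.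
    rewrite -zvec_linear; congr (zvec c X _ w).
    by apply/funext => u; exact: wordext_linear.
  rewrite mulmxDr -scalemxAr.
  by apply/matrixP => k j; rewrite !mxE.
have [direction [defect [direction_linear defect_linear] direction_sym]] :=
  topmat_interp.
have f_lin : linear (fun y => (defect y, rest y)).
  by move=> a y y'; rewrite defect_linear rest_lin.
have [|M dM MP] := kernel_image f_lin direction_linear.
  (* A zero direction has zero border vectors, and these are the rows of [y], all indexed by words
     shorter than d. *)
  move=> y [dy _] hy; apply: wordext_inj => a.
  have /andP[a0 am] := size_wd a.
  have ad : (size (wd a) < d)%N.
    by rewrite (leq_ltn_trans am) // /m; case: (d) d2 => [|[]].
  have [_ e] := direction_sym y dy.
  rewrite -topext_short // -e ?a0 ?(ltnW ad) // hy /=.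
  by rewrite ffunE mul0mx.
have sM : signed_subspace s p X v M.
  move=> H /MP[y [dy ry] ->]; have [Hs Hb] := direction_sym y dy; split=> //.
    rewrite ncder1E -(word_pairing_top y) /ncjet mulmx_suml; apply: eq_bigr => w _.
    rewrite -scalemxAl wordjet1_mul; congr (_ *: _); apply: eq_bigr => i _.
    rewrite Hb // size_drop subn_gt0 ltn_ord (leq_trans (leq_subr _ _)) //.
    exact: size_bseq.
  move=> H0; rewrite (qform_ncder2 c1 hankelE _ Xs Hs).
  have -> : @hessmat _ _ p c Q _ X (direction y) v =
      Q^T *m wordmat m (zvec c X (wordext y)).
    rewrite /hessmat; congr (_ *m _); apply/matrixP => i j; rewrite !mxE.
    have /andP[a0 am] := size_wd (enum_val i).
    congr (fun_of_matrix _ _ _); apply: eq_zvec => // u ua _ u0.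
    have ud : (size u < d)%N.
      rewrite (leq_ltn_trans ua) // (leq_ltn_trans am) // /m.
      by rewrite -/d; case: (d) d2 => [|[]].
    by rewrite Hb ?u0 1?ltnW // topext_short.
  set G := Q^T *m _.
  have rG k j : ~~ (0 < (-1) ^+ s * D 0 k) -> G k j = 0.
    move=> Dk; have Dk' : k \in [predC A] by [].
    have := congr1 (fun E : 'M[R]_(_, n) => E (enum_rank_in Dk' k) j) ry.
    by rewrite [LHS]mxE [RHS]mxE enum_rankK_in.
  (* Both the passage from [y] to the z-vectors and multiplication by [Q^T] are injective, so
     [G = 0] would force [y = 0] and a zero direction. *)
  have G0 : G != 0.
    apply: contra_neq H0 => G0.
    have -> : y = 0; last first.
      by move: (direction_linear (-1) 0 0); rewrite scaler0 addr0 scaleN1r addNr.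
    apply: (@zvec_inj c m n X) => // a.
    have z0 : wordmat m (zvec c X (wordext y)) = 0.
      rewrite -[LHS]mul1mx -trmx1 -(mulmxV Qu) trmx_mul.
      by rewrite -mulmxA -/G G0 mulmx0.
    apply/colP => j; have /matrixP/(_ (enum_rank a) j) := z0.
    by rewrite [LHS]mxE [RHS]mxE enum_rankK => ->; rewrite mxE.
  rewrite mulrCA mulr_gt0 // mulr_sumr.
  have ge0 k : true -> 0 <= (-1) ^+ s * (D 0 k * \sum_j G k j ^+ 2).
    move=> _; have [Dk|Dk] := boolP (0 < (-1) ^+ s * D 0 k).
      by rewrite mulrA mulr_ge0 ?(ltW Dk) // sumr_ge0 // => j _; exact: sqr_ge0.
    by rewrite big1 ?mulr0 // => j _; rewrite rG // expr0n.
  rewrite lt_neqAle sumr_ge0 // andbT eq_sym psumr_eq0 //.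
  apply: contra G0 => /allP h; apply/eqP/matrixP => k j; rewrite [RHS]mxE.
  have [Dk|Dk] := boolP (0 < (-1) ^+ s * D 0 k); last exact: rG.
  have := h k (mem_index_enum _); rewrite /= mulrA mulf_eq0 gt_eqF //=.
  rewrite psumr_eq0 => [|i _]; last exact: sqr_ge0.
  by move=> /allP/(_ j (mem_index_enum _)); rewrite /= sqrf_eq0 => /eqP.
have sig := signature_ge sM.
move: dM; rewrite dimv_prod dimv_ffun !dimv_mx card_ord.
have eN : (inertia s D + #|[predC A]| = N)%N by rewrite cardC card_ord.
have -> : (N * n = inertia s D * n + #|[predC A]| * n)%N by rewrite -mulnDl eN.
rewrite addnA leq_add2r mulnn => le.
by rewrite (leq_trans le) // leq_add2r.
Qed.

End Curvature.
End LowerBound.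

(** * The degree against the inertia of the Hankel matrix *)

Section CurvatureIndex.
Variables (R : realType) (g : nat).

(** The index set still contains the single letters, but u^T w always has length at least 2. *)
Lemma hankel_eq0 (p : ncpoly R g) : (ncdeg p < 2)%N -> hankel p = 0.
Proof.
move=> d2; apply/matrixP => i j; rewrite !mxE; apply: nccoef_eq0.
by rewrite (leq_trans d2) // size_cat size_rev /= addSn addnS.
Qed.

(** Cutting a word [W] of length d with nonzero coefficient after [k.+1] letters, for k < K, gives
    words u_k and w_k. The form vanishes on the span of the w_k, as their joint lengths exceed d,
    and pairs the u_k with the w_k by a triangular matrix [M] with diagonal [nccoef p W]. Such a
    form has at least K directions of either sign, and d <= 2 K + 2. *)
Lemma inertia_deg (p : ncpoly R g) (s : bool)
    (Q : 'M[R]_#|{: letword g (ncdeg p).-2}|) (D : 'rV[R]_#|{: letword g (ncdeg p).-2}|) :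
  nc_symmetric p -> hankel p = Q *m diag_mx D *m Q^T ->
  (ncdeg p <= 2 * inertia s D + 2)%N.
Proof.
move=> ps hE; set d := ncdeg p.
have [d2|d2] := leqP d 2; first exact: leq_trans d2 (leq_addl _ _).
have [W Wd W0] := ncdeg_coef (ltnW (ltnW d2) : (0 < ncdeg p)%N).
pose K := (d.-1)./2.
suff : (K <= inertia s D)%N.
  by rewrite /K; move: (inertia s D) d2; clear; case: (d) => [|e] I //= _; lia.
have K2 (k : 'I_K) : (k.+1 + K < d)%N.
  have := odd_double_half d.-1; rewrite -/K -addnn; have := ltn_ord k.
  by move: d2; clear; case: (odd _) => /=; lia.
have aP (k : 'I_K) : exists a : letword g d.-2, wd a = rev (take k.+1 W).
  apply: wd_surj; have k2 := K2 k.
  rewrite size_rev size_takel ?Wd -/d; last by move: k2; clear; lia.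
  by move: k2; case: (d) d2 => [|[|e]] //= _; clear; lia.
have bP (k : 'I_K) : exists a : letword g d.-2, wd a = drop k.+1 W.
  apply: wd_surj; have k2 := K2 k.
  rewrite size_drop Wd -/d.
  by move: k2; case: (d) d2 => [|[|e]] //= _; clear; lia.
have [a aE] := boolp.choice aP; have [b bE] := boolp.choice bP.
set A := hankel p.
have As : A^T = A by exact: tr_hankel.
have AE x y : A (enum_rank x) (enum_rank y) = nccoef p (rev (wd x) ++ wd y).
  by rewrite mxE !enum_rankK.
pose Eu := rowsub (fun k : 'I_K => enum_rank (a k)) (1%:M : 'M[R]_#|{: letword g d.-2}|).
pose Ew := rowsub (fun k : 'I_K => enum_rank (b k)) (1%:M : 'M[R]_#|{: letword g d.-2}|).
have selE (f h : 'I_K -> 'I_#|{: letword g d.-2}|) :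
    rowsub f 1%:M *m A *m (rowsub h 1%:M)^T = mxsub f h A.
  rewrite -rowsubE; apply/matrixP => k l.
  rewrite [LHS]mxE (bigD1 (h l)) //= big1 => [|i hi].
    by rewrite !mxE eqxx mulr1 addr0.
  by rewrite !mxE eq_sym (negPf hi) mulr0.
pose Q0 := Eu *m A *m Eu^T.
pose M := Eu *m A *m Ew^T.
have Q0s : Q0^T = Q0 by rewrite /Q0 !trmx_mul trmxK As mulmxA.
have ww : Ew *m A *m Ew^T = 0.
  rewrite selE; apply/matrixP => k l; rewrite [LHS]mxE [RHS]mxE AE.
  apply: nccoef_eq0; rewrite !bE size_cat size_rev !size_drop Wd -/d.
  by have := K2 k; have := K2 l; have := ltn_ord l; have := ltn_ord k; clear; lia.
have Mtr : is_trig_mx M^T.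
  apply/is_trig_mxP => k l kl; rewrite mxE /M selE mxE AE.
  apply: nccoef_eq0; rewrite aE bE revK size_cat size_drop size_takel Wd -/d.
    by have := K2 k; have := K2 l; move: kl; clear; lia.
  by have := K2 l; clear; lia.
have Mu : M^T \in unitmx.
  rewrite unitmxE (det_trig Mtr) unitfE; apply/prodf_neq0 => k _.
  by rewrite mxE /M selE mxE AE aE bE revK cat_take_drop.
(* Adding [C *m Ew] to [Eu] changes the form from [Q0] to [Q0 + 2 P], and this [P] makes the result
   the scalar matrix [(-1) ^+ s]. *)
pose P : 'M[R]_K := 2^-1 *: (((-1) ^+ s)%:M - Q0).
have Ps : P^T = P by rewrite /P trmxZ linearB /= Q0s tr_scalar_mx.
have [C CM] : exists C, C *m M^T = P by exists (P *m invmx M^T); rewrite mulmxKV.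
apply: (@inertia_ge _ s _ K Q D (Eu + C *m Ew)); rewrite -hE -/A.
have -> : (Eu + C *m Ew) *m A *m (Eu + C *m Ew)^T =
    Q0 + (C *m M^T)^T + (C *m M^T + C *m (Ew *m A *m Ew^T) *m C^T).
  have -> : (C *m M^T)^T = M *m C^T by rewrite trmx_mul trmxK.
  have -> : M^T = Ew *m A *m Eu^T by rewrite /M !trmx_mul trmxK As mulmxA.
  have -> : (Eu + C *m Ew)^T = Eu^T + Ew^T *m C^T by rewrite linearD /= trmx_mul.
  rewrite !mulmxDl !mulmxDr /M /Q0 !mulmxA.
  by [].
rewrite ww mulmx0 mul0mx addr0 CM Ps -addrA -scalerDl.
have -> : (2^-1 + 2^-1 : R) = 1 by field.
by rewrite scale1r addrC subrK.
Qed.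

Lemma inertia_deg_lt2 (p : ncpoly R g) (s : bool)
    (Q : 'M[R]_#|{: letword g (ncdeg p).-2}|) (D : 'rV[R]_#|{: letword g (ncdeg p).-2}|) :
  Q \in unitmx -> hankel p = Q *m diag_mx D *m Q^T -> (ncdeg p < 2)%N ->
  inertia s D = 0%N.
Proof.
move=> Qu hE /hankel_eq0; rewrite hE => e.
have D0 : diag_mx D = 0.
  rewrite -[LHS](mulKmx Qu) -[Q *m _](@mulmxK _ _ _ Q^T) ?unitmx_tr //.
  by rewrite e mul0mx mulmx0.
rewrite /inertia eq_card0 // => k; rewrite inE.
have := congr1 (fun A : 'M[R]_#|{: letword g (ncdeg p).-2}| => A k k) D0.
by rewrite !mxE eqxx mulr1n => ->; rewrite mulr0 ltxx.
Qed.

(* The bound [K] below does not depend on the size [n]. *)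
Lemma curvature_index (p : ncpoly R g) : nc_symmetric p ->
  exists mu : bool -> nat,
  [/\ forall s, (ncdeg p <= 2 * mu s + 2)%N,
      forall s, (ncdeg p < 2)%N -> mu s = 0%N,
      forall s n (X : mxtuple R g n) v, symtuple X ->
        (signature s p X v <= mu s * n)%N,
      exists K, forall s n (X : mxtuple R g n) v, symtuple X ->
        words_free (ncdeg p).-1 X v ->
        (mu s * n <= signature s p X v + K)%N
    & forall s n (X H : mxtuple R g n) v, symtuple X -> symtuple H ->
        mu s = 0%N -> (-1) ^+ s * qform (ncder2 p X H) v <= 0].
Proof.
move=> ps; have [c c0 c1] := sqrt_geometric R (ncdeg p).
have [Q [D [Qu hE]]] := sym_mx_congr_diag (tr_hankel ps).
exists (fun s => inertia s D); split=> [s|s d2|s n X v Xs||s n X H v Xs Hs mu0].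
- exact: inertia_deg hE.
- exact: inertia_deg_lt2 Qu hE d2.
- exact: (signature_le_inertia c1 hE).
- have [d2|d2] := ltnP 1 (ncdeg p); last first.
    by exists 0%N => s n X v _ _; rewrite (inertia_deg_lt2 s Qu hE).
  have [W Wd W0] := ncdeg_coef (ltnW d2).
  exists (g * (#|{: (ncdeg p).-1.-bseq 'I_g}| ^ 2))%N => s n X v Xs /row_freeP[B VB].
  exact: (signature_ge_inertia_aux d2 c0 c1 Qu hE Xs Wd W0 VB).
- rewrite (qform_ncder2 c1 hE v Xs Hs) mulrCA pmulr_rle0 //.
  apply: signed_sum_le0 => [k|k Dk].
    by apply: sumr_ge0 => j _; exact: sqr_ge0.
  by have := card0_eq mu0 k; rewrite inE Dk.
Qed.

End CurvatureIndex.

(** * Direct sums *)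

Section DirectSums.
Variables (R : realType) (g : nat).

Lemma mxcolZ t (n : 'I_t -> nat) m (a : R) (C : forall j, 'M[R]_(n j, m)) :
  \mxcol_j (a *: C j) = a *: \mxcol_j C j.
Proof. by apply/matrixP => i j; rewrite !mxE. Qed.

Lemma mxdiagZ_scale t (n : 'I_t -> nat) (a : R) (C : forall j, 'M[R]_(n j)) :
  \mxdiag_j (a *: C j) = a *: \mxdiag_j C j.
Proof.
apply/matrixP => i j; rewrite !mxE.
move: (tagnat.sig1 i) (tagnat.sig2 i) (tagnat.sig1 j) (tagnat.sig2 j).
move=> i1 i2 j1 j2; move: j2; case: (i1 =P j1) => [<-|_] j2.
  by rewrite !conform_mx_id mxE.
by rewrite !mxE mulr0.
Qed.

Definition dsum t (n : 'I_t -> nat) (X : forall j, mxtuple R g (n j)) :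
    mxtuple R g (\sum_j n j) := [ffun i => \mxdiag_(j < t) X j i].

Variables (t : nat) (n : 'I_t -> nat).
Implicit Types (X H : forall j, mxtuple R g (n j)) (v : forall j, 'cV[R]_(n j)).

Lemma dsumE X i : dsum X i = \mxdiag_(j < t) X j i.
Proof. by rewrite ffunE. Qed.

Lemma dsum_linear a X H :
  dsum (fun j => a *: X j + H j) = a *: dsum X + dsum H.
Proof.
apply/ffunP => i; rewrite [RHS]ffun_linE (dsumE X) (dsumE H).
rewrite (dsumE (fun j => a *: X j + H j)) -mxdiagZ_scale -mxdiagD.
by apply: eq_mxdiag => j; rewrite ffun_linE.
Qed.

Lemma dsum_eq0 X : dsum X = 0 -> forall j, X j = 0.
Proof.
move=> /ffunP X0 j; apply/ffunP => i; have := X0 i; rewrite dsumE.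
rewrite [X in _ = X]ffunE -[X in _ = X]mxdiag0 => /eq_mxdiagP/(_ j) ->.
by rewrite ffunE.
Qed.

Lemma symtuple_dsum X : (forall j, symtuple (X j)) -> symtuple (dsum X).
Proof.
move=> Xs i; rewrite ffunE tr_mxdiag; apply: eq_mxdiag => j; exact: Xs.
Qed.

(** Stated as an action on block columns, so that the induction only multiplies a block diagonal
    matrix by a block column. *)
Lemma wordjet_dsum X H k w m (C : forall j, 'M[R]_(n j, m)) :
  wordjet (dsum X) (dsum H) k w *m \mxcol_j C j =
  \mxcol_j (wordjet (X j) (H j) k w *m C j).
Proof.
elim: w k => [|i w IH] k /=.
  rewrite mul_scalar_mx -mxcolZ; apply: eq_mxcol => j.
  by rewrite mul_scalar_mx.
under [RHS]eq_mxcol => j do rewrite mulmxDl.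
rewrite mxcolD mulmxDl !ffunE; congr (_ + _).
  rewrite -mulmxA IH mul_mxdiag_mxcol; apply: eq_mxcol => j.
  by rewrite mulmxA.
case: k => [|k].
  by rewrite mul0mx -[LHS]mxcol0; apply: eq_mxcol => j; rewrite mul0mx.
rewrite -mulmxA IH mul_mxdiag_mxcol; apply: eq_mxcol => j.
by rewrite mulmxA.
Qed.

Lemma wordmx_dsum X w m (C : forall j, 'M[R]_(n j, m)) :
  wordmx (dsum X) w *m \mxcol_j C j = \mxcol_j (wordmx (X j) w *m C j).
Proof.
rewrite -(wordjet0 _ (dsum X)) wordjet_dsum; apply: eq_mxcol => j.
by rewrite wordjet0.
Qed.

Lemma ncjet_dsum p X H k v :
  ncjet p (dsum X) (dsum H) k *m \mxcol_j v j =
  \mxcol_j (ncjet p (X j) (H j) k *m v j).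
Proof.
rewrite /ncjet mulmx_suml.
under [RHS]eq_mxcol => j do rewrite mulmx_suml.
rewrite mxcol_sum; apply: eq_bigr => w _.
rewrite -scalemxAl wordjet_dsum -mxcolZ; apply: eq_mxcol => j.
by rewrite scalemxAl.
Qed.

Lemma qform_dsum p X H v :
  qform (ncder2 p (dsum X) (dsum H)) (\mxcol_j v j) =
  \sum_j qform (ncder2 p (X j) (H j)) (v j).
Proof.
rewrite /qform ncder2E -mulmxA -scalemxAl ncjet_dsum tr_mxcol -scalemxAr.
rewrite mul_mxrow_mxcol mxE summxE mulr_sumr; apply: eq_bigr => j _.
by rewrite ncder2E -scalemxAr -scalemxAl [RHS]mxE mulmxA.
Qed.

Definition vparam (V : vectType R) (U : {vspace V}) (x : 'rV[R]_(\dim U)) : V :=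
  \sum_i x 0 i *: (vbasis U)`_i.

Lemma vparam_linear (V : vectType R) (U : {vspace V}) a (x y : 'rV[R]_(\dim U)) :
  vparam (a *: x + y) = a *: vparam x + vparam y.
Proof.
rewrite /vparam scaler_sumr -big_split /=; apply: eq_bigr => i _.
by rewrite !mxE scalerDl scalerA.
Qed.

Lemma vparam_mem (V : vectType R) (U : {vspace V}) (x : 'rV[R]_(\dim U)) :
  vparam x \in U.
Proof.
apply: memv_suml => i _; apply: memvZ; apply: vbasis_mem.
by apply: mem_nth; rewrite size_tuple.
Qed.

Lemma vparam_inj (V : vectType R) (U : {vspace V}) (x : 'rV[R]_(\dim U)) :
  vparam x = 0 -> x = 0.
Proof.
move=> x0; have /freeP fr : free (vbasis U) by apply: basis_free (vbasisP U).
by apply/rowP => i; rewrite mxE (fr (fun i => x 0 i) x0).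
Qed.

(** Block diagonal directions with blocks in optimal subspaces: the first derivative and the Hessian
    form both split over the summands, and a sum of nonnegative terms vanishes only if every block
    is 0. *)
Lemma signature_dsum (p : ncpoly R g) s X v : (forall j, symtuple (X j)) ->
  (\sum_j signature s p (X j) (v j) <=
   signature s p (dsum X) (\mxcol_j v j))%N.
Proof.
move=> Xs.
pose W j := cid2 (signature_witness p s (X j) (v j)).
pose U j : {vspace mxtuple R g (n j)} := s2val (W j).
have sU j : signed_subspace s p (X j) (v j) (U j) := s2valP (W j).
have dU j : \dim (U j) = signature s p (X j) (v j) := s2valP' (W j).
under eq_bigr => j _ do rewrite -dU.
pose h (x : 'rV[R]_(\sum_j \dim (U j))) : mxtuple R g (\sum_j n j) :=
  dsum (fun j => vparam (submxrow x j)).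
have h_lin : linear h.
  move=> a x y; rewrite /h -dsum_linear; congr dsum.
  apply: functional_extensionality_dep => j.
  have -> : submxrow (a *: x + y) j = a *: submxrow x j + submxrow y j.
    by apply/matrixP => k l; rewrite !mxE.
  exact: vparam_linear.
(* No constraint is imposed here: the target of the zero map has dimension 0. *)
have z_lin : linear (fun _ : 'rV[R]_(\sum_j \dim (U j)) => 0 : 'M[R]_(0, 0)).
  by move=> a x y; rewrite scaler0 addr0.
have [|M dM MP] := kernel_image z_lin h_lin.
  move=> x _ /dsum_eq0 hx; apply/mxrowP => j; rewrite submxrow0.
  exact: vparam_inj (hx j).
move: dM; rewrite !dimv_mx mul1n muln0 addn0 => dM.
apply: (leq_trans dM); apply: signature_ge => H /MP[x _ ->] {H}.
have sx j := sU j _ (vparam_mem (submxrow x j)).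
split.
- by apply: symtuple_dsum => j; case: (sx j).
- rewrite ncder1E ncjet_dsum -[RHS]mxcol0; apply: eq_mxcol => j.
  by have [_ + _] := sx j; rewrite ncder1E.
- rewrite qform_dsum mulr_sumr => hx.
  have ge0 j : true -> 0 <= (-1) ^+ s *
      qform (ncder2 p (X j) (vparam (submxrow x j))) (v j).
    move=> _; have [_ _ pos] := sx j.
    have [->|/pos/ltW //] := eqVneq (vparam (submxrow x j)) 0.
    by rewrite ncder2E ncjet_dir0 scaler0 /qform mulmx0 mul0mx mxE mulr0.
  rewrite lt_neqAle sumr_ge0 // andbT eq_sym psumr_eq0 //.
  apply: contra hx => /allP a0; apply/eqP/ffunP => i.
  rewrite dsumE [RHS]ffunE -[RHS]mxdiag0.
  apply: eq_mxdiag => j; have := a0 j (mem_index_enum _); rewrite /= => /eqP q0.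
  have [_ _ pos] := sx j.
  have [->|/pos] := eqVneq (vparam (submxrow x j)) 0; first by rewrite ffunE.
  by rewrite q0 ltxx.
Qed.

Lemma vecmat_dsum m X v :
  vecmat m (dsum X) (\mxcol_j v j) = \mxrow_j vecmat m (X j) (v j).
Proof.
apply/matrixP => i k; rewrite [LHS]mxE wordmx_dsum !mxE.
by [].
Qed.

(** The matrix of a direct sum is the concatenation of those of the summands, so one summand with
    independent rows suffices. *)
Lemma words_free_dsum m X v j :
  words_free m (X j) (v j) -> words_free m (dsum X) (\mxcol_j v j).
Proof.
move=> fr; apply: inj_row_free => q; rewrite vecmat_dsum mul_mxrow => q0.
apply: (row_free_inj fr); rewrite mul0mx.
by have /mxrowP/(_ j) := q0; rewrite mxrowK submxrow0.
Qed.

End DirectSums.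

(** * Limits *)

Section Superadditive.
Variable R : realType.
Variables (a : nat -> nat) (C : nat).
Hypothesis aD : forall m n, (0 < m)%N -> (0 < n)%N -> (a m + a n <= a (m + n))%N.
Hypothesis aC : forall n, (0 < n)%N -> (a n <= C * n)%N.

Let u (n : nat) : R := (a n)%:R / n%:R.

Let aM q m : (0 < q)%N -> (0 < m)%N -> (q * a m <= a (q * m))%N.
Proof.
case: q => // q _ m0; elim: q => [|q IH]; first by rewrite !mul1n.
rewrite mulSn [X in (_ <= a X)%N]mulSn.
by rewrite (leq_trans _ (aD _ _)) ?muln_gt0 ?m0 // leq_add2l.
Qed.

Let aq n m : (0 < m <= n)%N -> (n %/ m * a m <= a n)%N.
Proof.
move=> /andP[m0 mn]; rewrite {2}(divn_eq n m).
have q0 : (0 < n %/ m)%N by rewrite divn_gt0.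
case: (posnP (n %% m)) => [->|r0]; first by rewrite addn0 aM.
rewrite (leq_trans (aM q0 m0)) // (leq_trans _ (aD _ r0)) ?leq_addr //.
by rewrite muln_gt0 q0.
Qed.

(** Fekete's lemma, with the supremum of the ratios as limit. Writing n = q m + r gives
    [a n >= q * a m], hence [u n >= u m - m * C / n]. *)
Lemma superadditive_cvg : exists l : R,
  u @ \oo --> l /\ forall n, (0 < n)%N -> u n <= l.
Proof.
pose E := [set u n | n in [set n | (0 < n)%N]].
have uC n : (0 < n)%N -> u n <= C%:R.
  by move=> n0; rewrite ler_pdivrMr ?ltr0n // -natrM ler_nat aC.
have supE : has_sup E.
  split; first by exists (u 1%N), 1%N.
  by exists C%:R => _ [n n0 <-]; exact: uC.
exists (sup E).
have uE n : (0 < n)%N -> u n <= sup E.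
  by move=> n0; apply: (ub_le_sup supE.2); exists n.
split=> //; apply/cvgrPdist_le => e e0.
have e2 : 0 < e / 2 by rewrite divr_gt0.
have [_ [m m0 <-] lm] := sup_adherent e2 supE.
(* For [n >= N] the error [m * C / n] is at most [e / 2]. *)
pose N := (Num.trunc (2 * m%:R * C%:R / e)).+1.
have Nge : 2 * m%:R * C%:R / e < N%:R by rewrite /N truncnS_gt.
near=> n.
have mn : (m <= n)%N by near: n; exact: nbhs_infty_ge.
have Nn : (N <= n)%N by near: n; exact: nbhs_infty_ge.
have n0 : (0 < n)%N by rewrite (leq_trans _ mn).
have nR : 0 < n%:R :> R by rewrite ltr0n.
have mR : 0 < m%:R :> R by rewrite ltr0n.
rewrite ger0_norm ?subr_ge0 ?uE // lerBlDr -lerBlDl.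
have : u m - m%:R * C%:R / n%:R <= u n.
  have /aq : (0 < m <= n)%N by rewrite mn andbT.
  rewrite -(ler_nat R) natrM => h.
  rewrite /u ler_pdivlMr // mulrBl divfK ?gt_eqF // (le_trans _ h) //.
  rewrite lerBlDr -lerBlDl.
  have qm : n%:R <= (n %/ m)%:R * m%:R + m%:R :> R.
    rewrite -natrM -natrD ler_nat {1}(divn_eq n m) leq_add2l ltnW //.
    by rewrite ltn_mod.
  have um0 : 0 <= u m by rewrite divr_ge0.
  have -> : (a m)%:R / m%:R * n%:R - (n %/ m)%:R * (a m)%:R =
      u m * (n%:R - (n %/ m)%:R * m%:R).
    by rewrite /u; field; rewrite gt_eqF.
  rewrite (le_trans (ler_wpM2l um0 (_ : _ <= m%:R))) //; first by rewrite lerBlDl.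
  by rewrite mulrC ler_wpM2l ?ler0n // uC.
apply: le_trans.
have : m%:R * C%:R / n%:R <= e / 2.
  have h : 2 * m%:R * C%:R <= n%:R * e.
    by rewrite -ler_pdivrMr // (le_trans (ltW Nge)) // ler_nat.
  rewrite ler_pdivrMr //; move: h.
  by move: (m%:R) (C%:R) (n%:R) => x y z; lra.
by move: lm; move: (u m) (sup E) (_ / n%:R) => x y z; lra.
Unshelve. all: by end_near.
Qed.

End Superadditive.

(** * Direct sums within a graded set *)

Section GradedSets.
Variables (R : realType) (g : nat) (S : ncset R g).
Arguments S : clear implicits.
Hypothesis Ssum : respects_direct_sums S.

Lemma dsum_const_mem k n (X : mxtuple R g n) (v : 'cV[R]_n) :
  (0 < k)%N -> (0 < n)%N -> S n (X, v) ->
  S _ (dsum (fun _ : 'I_k => X), \mxcol_(_ < k) v).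
Proof.
by move=> k0 n0 SX; apply: (@Ssum k (fun=> n) (fun=> X) (fun=> v)).
Qed.

(** Direct sums of copies of a point of size one reach every size, so each supremum is over a
    nonempty set. *)
Lemma graded_nonempty n : S 1%N !=set0 -> (0 < n)%N -> S n !=set0.
Proof.
move=> [[X v] SX] n0.
have : S (\sum_(j < n) 1)%N !=set0.
  by eexists; exact: (dsum_const_mem n0 _ SX).
by rewrite sum1_card card_ord.
Qed.

(** A linear relation among the vectors w(X) v of a direct sum holds in each summand. *)
Lemma exists_common_free n1 n2 (X1 : mxtuple R g n1) v1 (X2 : mxtuple R g n2) v2 :
    (0 < n1)%N -> (0 < n2)%N -> S n1 (X1, v1) -> S n2 (X2, v2) ->
  exists n (X : mxtuple R g n) v, [/\ (0 < n)%N, S n (X, v) &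
    forall m (q : 'rV[R]_#|{: m.-bseq 'I_g}|), q *m vecmat m X v = 0 ->
      q *m vecmat m X1 v1 = 0 /\ q *m vecmat m X2 v2 = 0].
Proof.
move=> n10 n20 S1 S2.
pose T := {n : nat & (mxtuple R g n * 'cV[R]_n)%type}.
pose pt (j : 'I_2) : T := if j == 0 then existT _ n1 (X1, v1) else existT _ n2 (X2, v2).
pose n j := tag (pt j); pose X j := (tagged (pt j)).1.
pose v j := (tagged (pt j)).2.
exists (\sum_j n j)%N, (dsum X), (\mxcol_j v j); split.
- by rewrite big_ord_recl ltn_addr.
- apply: Ssum => // j; rewrite ?/n ?/X ?/v /pt; by case: (j == 0).
- move=> m q; rewrite vecmat_dsum mul_mxrow => /mxrowP q0.
  have {}q0 j : q *m vecmat m (X j) (v j) = 0.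
    by have := q0 j; rewrite mxrowK submxrow0.
  split; first exact: (q0 0).
  exact: (q0 1).
Qed.

(** This passes from one point per relation to one point for all of them: at a point of maximal
    rank, a remaining relation [q] would be destroyed by adding a summand where it fails, which
    would raise the rank. *)
Lemma exists_words_free m :
    (exists2 n, (0 < n)%N & S n !=set0) ->
    (forall q : 'rV[R]_#|{: m.-bseq 'I_g}|, q != 0 -> exists n (X : mxtuple R g n) v,
       [/\ (0 < n)%N, S n (X, v) & q *m vecmat m X v != 0]) ->
  exists n (X : mxtuple R g n) v, [/\ (0 < n)%N, S n (X, v) & words_free m X v].
Proof.
move=> S0 Sq.
pose P r := `[< exists n (X : mxtuple R g n) v,
  [/\ (0 < n)%N, S n (X, v) & \rank (vecmat m X v) = r] >].
have Pex : exists r, P r.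
  case: S0 => n n0 [[X v] SX].
  by exists (\rank (vecmat m X v)); apply/asboolP; exists n, X, v.
have Pub r : P r -> (r <= #|{: m.-bseq 'I_g}|)%N.
  by move=> /asboolP[n [X [v [_ _ <-]]]]; exact: rank_leq_row.
case: (ex_maxnP Pex Pub) => r /asboolP[n [X [v [n0 SX Xr]]]] rmax.
exists n, X, v; split=> //; rewrite /words_free.
rewrite -kermx_eq0; apply: contraT => kA.
set q := nz_row (kermx (vecmat m X v)).
have [|n' [X' [v' [n'0 SX' qX']]]] := Sq q; first by rewrite nz_row_eq0.
have qX : q *m vecmat m X v = 0 by apply/sub_kermxP; exact: nz_row_sub.
have [n2 [X2 [v2 [n20 SX2 h]]]] := exists_common_free n0 n'0 SX SX'.
have : (\rank (kermx (vecmat m X2 v2)) < \rank (kermx (vecmat m X v)))%N.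
  apply: rank_ltmx; rewrite ltmxE; apply/andP; split.
    apply/sub_kermxP/row_matrixP => i; rewrite row_mul row0.
    by apply: (proj1 (h _ _ _)); rewrite -row_mul mulmx_ker row0.
  apply: contra qX' => /(submx_trans (nz_row_sub _))/sub_kermxP/h[_ ->].
  exact: eqxx.
have : (\rank (vecmat m X2 v2) <= r)%N.
  by apply: rmax; apply/asboolP; exists n2, X2, v2.
rewrite !mxrank_ker Xr => le; rewrite ltnNge leq_sub2l //.
Qed.

End GradedSets.

(** * Existence and value of the limit of the densities *)

Section SignatureLimit.
Variables (R : realType) (g : nat) (p : ncpoly R g).
Hypothesis psym : nc_symmetric p.

(** A nonzero row [q] holds the coefficients of a nonzero polynomial [P] of degree below that of
    [p]; by minimality [P] does not vanish on all of [S]. *)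
Lemma min_degree_free (S : ncset R g) : (0 < ncdeg p)%N ->
    respects_direct_sums S -> min_degree_defining0 p S ->
  exists n (X : mxtuple R g n) v,
    [/\ (0 < n)%N, S n (X, v) & words_free (ncdeg p).-1 X v].
Proof.
move=> d0 Ssum [S0 pmin _]; set m := (ncdeg p).-1.
apply: exists_words_free => // q q0; apply: contrapT => noX.
pose P : ncpoly R g := \sum_i << q 0 i *g FMonom (bseqval (enum_val i)) >>.
have Pcoef w : nccoef P w = if insub w is Some b then q 0 (enum_rank b) else 0.
  rewrite /nccoef /P raddf_sum /=.
  under eq_bigr => i _ do rewrite mcoeffU.
  case: insubP => [b _ bw|wm].
    rewrite (bigD1 (enum_rank b)) //= big1 => [|i ib].
      by rewrite addr0 enum_rankK bw eqxx mulr1n.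
    case: eqP => // -[iw]; case/eqP: ib; rewrite -(enum_valK i); congr enum_rank.
    by apply: val_inj; rewrite /= bw.
  apply: big1 => i _; case: eqP => // -[iw].
  by case/negP: wm; rewrite -iw; exact: size_bseq.
have Pdeg : (ncdeg P <= m)%N.
  apply/bigmax_leqP_seq => -[w] wP _; rewrite leqNgt; apply/negP => mw.
  move: wP; rewrite -mcoeff_neq0 -/(nccoef P w) Pcoef insubF ?eqxx //.
  by apply/negbTE; rewrite -ltnNge.
have P0 : P != 0.
  apply: contra_neq q0 => P0; apply/rowP => i.
  have := Pcoef (enum_val i); rewrite P0 /nccoef mcoeff0 insubT ?size_bseq // => wm.
  rewrite mxE => ->; congr (q 0 _); rewrite -[LHS]enum_valK.
  by congr enum_rank; exact: val_inj.
suff /(pmin _ P0) : vanishes_on P S.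
  by rewrite leqNgt (leq_ltn_trans Pdeg) // /m ltn_predL.
move=> n X v n0 SX; rewrite (nceval_words _ Pdeg) mulmx_suml.
have /rowP qX : q *m vecmat m X v = 0.
  apply: contrapT => qX; apply: noX; exists n, X, v; split=> //.
  exact/eqP.
apply/colP => i; have := qX i; rewrite !mxE => <-; rewrite summxE.
rewrite (reindex _ (onW_bij _ (enum_val_bij _))) /=; apply: eq_bigr => j _.
rewrite -scalemxAl mxE [vecmat _ _ _ _ _]mxE Pcoef; congr (_ * _).
rewrite insubT ?size_bseq // => wm.
by congr (q 0 _); rewrite -[RHS]enum_valK; congr enum_rank; exact: val_inj.
Qed.

Section Limit.
Variable S : ncset R g.
Arguments S : clear implicits.
Hypotheses (SV : ncsubset S (ncvariety p)) (Ssum : respects_direct_sums S)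
  (S1 : S 1%N !=set0).

Let symS n X v : (0 < n)%N -> S n (X, v) -> symtuple X.
Proof. by move=> n0 /(SV n0)[]. Qed.

(** The signatures at a given size are bounded integers, so their supremum is attained. *)
Let max_signature s n : (0 < n)%N -> { Xv : mxtuple R g n * 'cV[R]_n |
  S n Xv /\ forall Yw, S n Yw ->
    (signature s p Yw.1 Yw.2 <= signature s p Xv.1 Xv.2)%N }.
Proof.
move=> n0; apply: cid.
pose P k := `[< exists2 Xv, S n Xv & signature s p Xv.1 Xv.2 = k >].
have Pex : exists k, P k.
  have [Xv SX] := graded_nonempty Ssum S1 n0.
  by exists (signature s p Xv.1 Xv.2); apply/asboolP; exists Xv.
have Pub k : P k -> (k <= \dim {: mxtuple R g n})%N.
  move=> /asboolP[Xv _ <-]; apply: signature_le => U _.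
  exact: dimvS (subvf _).
case: (ex_maxnP Pex Pub) => k /asboolP[Xv SX <-] kmax.
exists Xv; split=> // Yw SY; apply: kmax; apply/asboolP.
by exists Yw.
Qed.

(** The maximal signature [a n] is superadditive, because direct sums stay in [S], and at most
    [mu s * n], so Fekete's lemma applies. The last two clauses make [l] the least upper bound of
    all the ratios. *)
Lemma signature_density_cvg s : exists l : R,
  [/\ signature_density s p S @ \oo --> l,
      forall n X v, (0 < n)%N -> S n (X, v) ->
        (signature s p X v)%:R / n%:R <= l
    & forall b : R, (forall n X v, (0 < n)%N -> S n (X, v) ->
        (signature s p X v)%:R / n%:R <= b) -> l <= b].
Proof.
have [mu [_ _ muP _ _]] := curvature_index psym.
pose best n (n0 : (0 < n)%N) := sval (max_signature s n0).
pose a n := if pselect (0 < n)%N is left n0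
  then signature s p (best n n0).1 (best n n0).2 else 0%N.
have aE n (n0 : (0 < n)%N) : a n = signature s p (best n n0).1 (best n n0).2.
  by rewrite /a; case: pselect => // n0'; rewrite (bool_irrelevance n0' n0).
have Sbest n (n0 : (0 < n)%N) : S n (best n n0).
  by rewrite /best; case: (max_signature s n0) => Xv [].
have symb n (n0 : (0 < n)%N) : symtuple (best n n0).1.
  by have := Sbest n n0; case: (best n n0) => X v; exact: symS.
have amax n X v : (0 < n)%N -> S n (X, v) -> (signature s p X v <= a n)%N.
  move=> n0 SX; rewrite (aE n n0) /best.
  by case: (max_signature s n0) => Xv [_ /= h]; exact: (h _ SX).
have aD m n : (0 < m)%N -> (0 < n)%N -> (a m + a n <= a (m + n))%N.
  move=> m0 n0; pose N (j : 'I_2) := if j == 0 then m else n.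
  have N0 j : (0 < N j)%N by rewrite /N; case: ifP.
  have SN : S _ (dsum (fun j => (best _ (N0 j)).1), \mxcol_j (best _ (N0 j)).2).
    apply: Ssum => // j; rewrite -surjective_pairing; exact: Sbest.
  have Nmn : (\sum_j N j)%N = (m + n)%N by rewrite big_ord_recl big_ord1.
  have Npos : (0 < \sum_j N j)%N by rewrite Nmn addn_gt0 m0.
  rewrite -Nmn; apply: leq_trans (amax _ _ _ Npos SN).
  apply: leq_trans (signature_dsum _ _ _ _).
    by under eq_bigr => j _ do rewrite -aE; rewrite big_ord_recl big_ord1.
  by move=> j; exact: symb.
have aC n : (0 < n)%N -> (a n <= mu s * n)%N.
  move=> n0; rewrite (aE n n0); apply: muP; exact: symb.
have densE n : (0 < n)%N -> signature_density s p S n = (a n)%:R / n%:R.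
  move=> n0; rewrite /signature_density; apply/eqP; rewrite eq_le; apply/andP; split.
    apply: ge_sup.
      by exists ((signature s p (best n n0).1 (best n n0).2)%:R / n%:R), (best n n0).
    move=> _ [[X v] SX <-]; rewrite ler_pM2r ?invr_gt0 ?ltr0n // ler_nat.
    exact: amax.
  apply: ub_le_sup; last by exists (best n n0); rewrite // (aE n n0).
  exists ((a n)%:R / n%:R) => _ [[X v] SX <-].
  by rewrite ler_pM2r ?invr_gt0 ?ltr0n // ler_nat amax.
have [l [al le_l]] := superadditive_cvg R aD aC.
exists l; split.
- apply: cvg_trans al; apply: near_eq_cvg; near=> n; rewrite densE //.
  by near: n; exact: nbhs_infty_gt.
- move=> n X v n0 SX; apply: le_trans (le_l n n0).
  by rewrite ler_pM2r ?invr_gt0 ?ltr0n // ler_nat amax.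
- move=> b hb; rewrite -(cvg_lim _ al) //; apply: limr_le.
    by apply/cvg_ex; exists l.
  near=> n; have n0 : (0 < n)%N by near: n; exact: nbhs_infty_gt.
  rewrite (aE n n0); apply: hb => //; rewrite -surjective_pairing.
  exact: Sbest.
Unshelve. all: by end_near.
Qed.

(** Against [l < mu]: for [k] copies of a free point, of total size [N], the lower bound gives
    [mu * N <= l * N + K], which fails for large [k] because [K] is constant. *)
Lemma signature_limit_index s (mu K : nat) :
    (forall n (X : mxtuple R g n) v, symtuple X -> (signature s p X v <= mu * n)%N) ->
    (forall n (X : mxtuple R g n) v, symtuple X ->
      words_free (ncdeg p).-1 X v -> (mu * n <= signature s p X v + K)%N) ->
    ((0 < mu)%N -> exists n (X : mxtuple R g n) v,
      [/\ (0 < n)%N, S n (X, v) & words_free (ncdeg p).-1 X v]) ->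
  signature_limit s p S = mu%:R.
Proof.
move=> ub lb free; have [l [cl ge_l le_l]] := signature_density_cvg s.
rewrite /signature_limit (cvg_lim _ cl) //; apply/eqP; rewrite eq_le; apply/andP; split.
  apply: le_l => n X v n0 SX; rewrite ler_pdivrMr ?ltr0n // -natrM ler_nat.
  exact: ub (symS n0 SX).
have [->|mu0] := posnP mu.
  have [[X v] SX] := S1; apply: le_trans (ge_l 1%N X v isT SX).
  by rewrite divr_ge0.
have [n [X [v [n0 SX fr]]]] := free mu0.
rewrite leNgt; apply/negP => lmu.
have e0 : 0 < mu%:R - l by rewrite subr_gt0.
pose k := (Num.trunc (K%:R / (mu%:R - l))).+1.
have Kk : K%:R < k%:R * (mu%:R - l) by rewrite -ltr_pdivrMr // truncnS_gt.
pose N := (\sum_(j < k) n)%N.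
have Nk : N = (k * n)%N by rewrite /N sum_nat_const card_ord.
have N0 : (0 < N)%N by rewrite Nk muln_gt0.
have SN := dsum_const_mem Ssum (ltn0Sn _ : (0 < k)%N) n0 SX.
have frN : words_free (ncdeg p).-1 (dsum (fun _ : 'I_k => X)) (\mxcol_(j < k) v).
  exact: (@words_free_dsum _ _ k (fun=> n) _ (fun=> X) (fun=> v) ord0 fr).
have := ge_l _ _ _ N0 SN; have := lb _ _ _ (symS N0 SN) frN.
rewrite -/N ler_pdivrMr ?ltr0n // -(ler_nat R) natrD natrM => h1 h2.
have kN : k%:R <= N%:R :> R by rewrite ler_nat Nk leq_pmulr.
have h3 : k%:R * (mu%:R - l) <= N%:R * (mu%:R - l) by rewrite ler_wpM2r // ltW.
move: (le_trans h1 (lerD h2 (lexx K%:R))) (lt_le_trans Kk h3).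
by rewrite mulrBr; lra.
Qed.

End Limit.
End SignatureLimit.

(** * Convex polynomials *)

Section Fock.
Variables (R : realType) (g m : nat).
Let N := #|{: m.-bseq 'I_g}|.
Let word (i : 'I_N) : m.-bseq 'I_g := enum_val i.

(* Truncated creation plus annihilation operators. *)
Let fock : mxtuple R g N := [ffun j => \matrix_(a, b)
  ((word a == j :: word b :> seq _) || (word b == j :: word a :> seq _))%:R].

Let vacuum : 'cV[R]_N := \col_a (word a == [::] :> seq _)%:R.

(** Each letter raises the length by at most one, so at words of length [size u] or more only the
    path made of creations contributes. *)
Let fock_word u (a : 'I_N) : (size u <= size (word a))%N ->
  (wordmx fock u *m vacuum) a 0 = (word a == u :> seq _)%:R.
Proof.
elim: u a => [|j u IH] a ua; first by rewrite wordmx_nil mul1mx mxE.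
rewrite wordmx_cons -mulmxA mxE.
transitivity (\sum_b (if (word a == j :: word b :> seq _) &&
    (word b == u :> seq _) then 1 else 0 : R)).
  apply: eq_bigr => b _; rewrite ffunE mxE.
  have [ab|nab] := eqVneq (bseqval (word a)) (j :: word b).
    rewrite /= mul1r IH; first by case: (_ == u).
    by move: ua; rewrite ab.
  have [ba|nba] := eqVneq (bseqval (word b)) (j :: word a); last by rewrite mul0r.
  rewrite mul1r IH; last by rewrite ba /= leqW // (leq_trans _ ua).
  case: eqP => // bu; have := ua; rewrite -bu ba /=.
  by rewrite ltnNge leqW.
have [aju|naju] := eqVneq (bseqval (word a)) (j :: u); last first.
  apply: big1 => b _; case: ifP => // /andP[/eqP ab /eqP bu].
  by case/eqP: naju; rewrite ab bu.
have um : (size u <= m)%N by rewrite ltnW // (leq_trans ua) // size_bseq.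
have wu : word (enum_rank (Bseq um)) = u :> seq _ by rewrite /word enum_rankK.
rewrite (bigD1 (enum_rank (Bseq um))) //= wu aju !eqxx /= big1 ?addr0 // => b bu.
case: ifP => // /andP[_ /eqP wb]; case/eqP: bu; rewrite -[LHS]enum_valK.
by congr enum_rank; exact: val_inj.
Qed.

(** In a relation [q], the coordinate of a longest word with nonzero coefficient receives a
    contribution from that word alone. *)
Lemma exists_sym_words_free : exists n (X : mxtuple R g n) (v : 'cV[R]_n),
  [/\ (0 < n)%N, symtuple X & words_free m X v].
Proof.
exists N, fock, vacuum; split.
- by apply/card_gt0P; exists [bseq].
- by move=> j; apply/matrixP => a b; rewrite ffunE !mxE orbC.
- apply: inj_row_free => q q0; apply/eqP; apply: contraT => /rV0Pn[i0 qi0].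
  case: (@arg_maxnP _ i0 (fun i => q 0 i != 0) (fun i => size (word i)) qi0) => i qi imax.
  have /rowP/(_ i) := q0; rewrite mxE [RHS]mxE (bigD1 i) //= big1 => [|k ki].
    by rewrite mxE fock_word // eqxx mulr1 addr0 => qi'; rewrite qi' eqxx in qi.
  have [->|qk] := eqVneq (q 0 k) 0; first by rewrite mul0r.
  rewrite mxE fock_word; last exact: imax.
  case: eqP => [ik|_]; last by rewrite mulr0.
  by case/eqP: ki; apply: enum_val_inj; exact/val_inj/esym.
Qed.

End Fock.

(** * Convexity and the sign of the Hessian *)

Section Convexity.
Variables (R : realType) (g : nat).

Lemma poly_ge0_at0 (q : {poly R}) : (forall t, 0 < t -> 0 <= q.[t]) -> 0 <= q.[0].
Proof.
move=> q0; have cq : q.[x] @[x --> 0^'+] --> q.[0].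
  by apply: cvg_at_right_filter; exact: continuous_horner.
rewrite -(cvg_lim _ cq) //; apply: limr_ge; first by apply/cvg_ex; exists q.[0].
by near=> t; apply: q0; near: t; exact: nbhs_right_gt.
Unshelve. all: by end_near.
Qed.

(** The polynomial G(t) = q(t) + q(-t) has no linear term, so G(t) - G(0) is t^2 times a polynomial
    that is nonnegative for t > 0. By continuity it is so at 0, where its value is twice the
    coefficient wanted. *)
Lemma poly_midpoint_coef2 (q : {poly R}) :
  (forall t, 2 * q.[0] <= q.[t] + q.[- t]) -> 0 <= q`_2.
Proof.
move=> qmid; pose G := \poly_(k < size q) (q`_k + (-1) ^+ k * q`_k).
have Gt t : G.[t] = q.[t] + q.[- t].
  rewrite horner_poly !horner_coef -big_split /=; apply: eq_bigr => k _.
  by rewrite [(- t) ^+ k]exprNn mulrDl mulrCA !mulrA.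
have Gk k : G`_k = q`_k + (-1) ^+ k * q`_k.
  by rewrite coef_poly; case: ltnP => // /(nth_default 0) ->; rewrite mulr0 addr0.
have q0 : 0 <= (drop_poly 2 G).[0].
  apply: poly_ge0_at0 => t t0.
  have := Gt t; rewrite -{1}(poly_take_drop 2 G) hornerD hornerM hornerXn.
  rewrite horner_poly !big_ord_recl big_ord0 /= !Gk expr0 expr1 => e.
  have := qmid t; rewrite -e -horner_coef0 mulN1r subrr mul0r !addr0 mul1r mulr1.
  rewrite mulr_natl mulr2n lerDl => h.
  by move: h; rewrite pmulr_lge0 // exprn_gt0.
move: q0; rewrite horner_coef0 coef_drop_poly add0n Gk sqrrN expr1n mul1r.
by lra.
Qed.

Lemma qform_lin n a (A B : 'M[R]_n) v :
  qform (a *: A + B) v = a * qform A v + qform B v.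
Proof. by rewrite /qform mulmxDr mulmxDl -scalemxAr -scalemxAl !mxE. Qed.

Lemma qform0 n v : qform (0 : 'M[R]_n) v = 0.
Proof. by rewrite /qform mulmx0 mul0mx mxE. Qed.

Lemma qformZ n a (A : 'M[R]_n) v : qform (a *: A) v = a * qform A v.
Proof. by rewrite -[a *: A]addr0 qform_lin qform0 addr0. Qed.

Lemma qformD n (A B : 'M[R]_n) v : qform (A + B) v = qform A v + qform B v.
Proof. by rewrite -[A in LHS]scale1r qform_lin mul1r. Qed.

Lemma qformN n (A : 'M[R]_n) v : qform (- A) v = - qform A v.
Proof. by rewrite -scaleN1r qformZ mulN1r. Qed.

(** The points X + tH and X - tH have midpoint X, so convexity with weight 1/2 gives the hypothesis
    of [poly_midpoint_coef2] for the polynomial <p(X + tH) v, v> in t. *)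
Lemma convex_ncder2_ge0 (p : ncpoly R g) n (X H : mxtuple R g n) v :
  nc_convex p -> symtuple X -> symtuple H -> 0 <= qform (ncder2 p X H) v.
Proof.
move=> pconv Xs Hs; pose q := \poly_(k < (ncdeg p).+1) qform (ncjet p X H k) v.
have qE t : q.[t] = qform (nceval p (X + t *: H)) v.
  rewrite horner_poly (nceval_line _ _ _ (leqnn _)).
  rewrite (big_morph (fun A => qform A v) (fun A B => qformD A B v) (qform0 v)).
  by apply: eq_bigr => k _; rewrite qformZ mulrC.
have Xt t : symtuple (X + t *: H).
  by move=> i; rewrite !ffunE linearD /= trmxZ Xs Hs.
rewrite ncder2E qformZ mulr_ge0 //.
have <- : q`_2 = qform (ncjet p X H 2) v.
  rewrite coef_poly; case: ltnP => // d2.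
  by rewrite ncjet_eq0 // qform0.
apply: poly_midpoint_coef2 => t.
have h2 : 0 <= (2^-1 : R) <= 1 by apply/andP; split; lra.
have [_ /(_ v)] := pconv n (X + t *: H) (X + (- t) *: H) 2^-1 (Xt t) (Xt (- t)) h2.
have -> : 2^-1 *: (X + t *: H) + (1 - 2^-1) *: (X + - t *: H) = X + 0 *: H.
  have -> : 1 - 2^-1 = 2^-1 :> R by field.
  rewrite !scalerDr !scalerA addrACA -!scalerDl mulrN subrr.
  have -> : 2^-1 + 2^-1 = 1 :> R by field.
  by rewrite scale1r.
rewrite !(qformD, qformN, qformZ) -!qE; lra.
Qed.

Lemma tr_nceval (p : ncpoly R g) n (X : mxtuple R g n) :
  nc_symmetric p -> symtuple X -> (nceval p X)^T = nceval p X.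
Proof.
move=> ps Xs; rewrite (nceval_words _ (leqnn _)) linear_sum /=.
pose r (w : (ncdeg p).-bseq 'I_g) : (ncdeg p).-bseq 'I_g := [bseq of rev w].
have rK : involutive r by move=> w; apply: val_inj; rewrite /= revK.
rewrite (reindex_inj (inv_inj rK)) /=; apply: eq_bigr => w _.
by rewrite trmxZ (nccoef_rev _ ps) wordmx_rev // trmxK.
Qed.

(** In degree at most 2 the Taylor expansion stops at second order, and the convexity defect at [t]
    is exactly t (1 - t) / 2 times p''(Y)[X - Y]. *)
Lemma convex_of_ncder2_ge0 (p : ncpoly R g) : nc_symmetric p ->
    (ncdeg p <= 2)%N ->
    (forall n (X H : mxtuple R g n) v, symtuple X -> symtuple H ->
      0 <= qform (ncder2 p X H) v) ->
  nc_convex p.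
Proof.
move=> ps d2 pos n X Y t Xs Ys /andP[t0 t1].
pose H := X - Y.
have Hs : symtuple H by move=> i; rewrite !ffunE linearB /= Xs Ys.
have line (s : R) : s *: X + (1 - s) *: Y = Y + s *: H.
  by rewrite scalerBl scale1r addrCA -scalerBr.
have Zs : symtuple (t *: X + (1 - t) *: Y).
  by rewrite line => i; rewrite !ffunE linearD /= trmxZ linearB /= Xs Ys.
split=> [|u].
  by rewrite linearB linearD /= !trmxZ !tr_nceval.
have -> : t *: nceval p X + (1 - t) *: nceval p Y - nceval p (t *: X + (1 - t) *: Y)
    = (t * (1 - t) / 2) *: ncder2 p Y H.
  have PE (s : R) : nceval p (Y + s *: H) =
      ncjet p Y H 0 + s *: ncjet p Y H 1 + s ^+ 2 *: ncjet p Y H 2.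
    rewrite (nceval_line _ _ _ d2) !big_ord_recl big_ord0 addr0 expr0 scale1r.
    by rewrite addrA.
  have PX : nceval p X = ncjet p Y H 0 + ncjet p Y H 1 + ncjet p Y H 2.
    by have := PE 1; rewrite expr1n !scale1r /H addrC subrK.
  have PY : nceval p Y = ncjet p Y H 0.
    by have := PE 0; rewrite expr0n !scale0r !addr0.
  rewrite line PE PX PY ncder2E.
  move: (ncjet p Y H 0) (ncjet p Y H 1) (ncjet p Y H 2) => J0 J1 J2.
  by apply/matrixP => i j; rewrite !mxE; field.
by rewrite qformZ mulr_ge0 ?pos // divr_ge0 // mulr_ge0 // subr_ge0.
Qed.

Lemma ncdegN (p : ncpoly R g) : ncdeg (- p) = ncdeg p.
Proof. by rewrite /ncdeg msuppN. Qed.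

Lemma nccoefN (p : ncpoly R g) w : nccoef (- p) w = - nccoef p w.
Proof. exact: mcoeffN. Qed.

Lemma nc_symmetricN (p : ncpoly R g) : nc_symmetric p -> nc_symmetric (- p).
Proof.
rewrite /nc_symmetric /nctr msuppN => ps; rewrite -[in RHS]ps -sumrN.
by apply: eq_bigr => w _; rewrite mcoeffN monalgUN.
Qed.

Lemma ncjetN (p : ncpoly R g) n (X H : mxtuple R g n) k :
  ncjet (- p) X H k = - ncjet p X H k.
Proof.
rewrite /ncjet ncdegN -sumrN; apply: eq_bigr => w _.
by rewrite nccoefN scaleNr.
Qed.

Lemma signed_subspaceN s (p : ncpoly R g) n (X : mxtuple R g n) v U :
  signed_subspace s (- p) X v U -> signed_subspace (~~ s) p X v U.
Proof.
move=> sU H HU; have [Hs H1 H2] := sU H HU; split; first exact: Hs.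
  by apply/eqP; rewrite -oppr_eq0 -mulNmx ncder1E -ncjetN -ncder1E H1.
move=> /H2; rewrite !ncder2E ncjetN !qformZ qformN.
by case: (s); rewrite ?expr0 ?expr1; lra.
Qed.

Lemma signatureN s (p : ncpoly R g) n (X : mxtuple R g n) v :
  signature s (- p) X v = signature (~~ s) p X v.
Proof.
apply/eqP; rewrite eqn_leq; apply/andP; split; apply: signature_le => U sU.
  by apply: signature_ge; exact: signed_subspaceN.
apply: signature_ge; rewrite -[s]negbK; apply: signed_subspaceN.
by rewrite opprK.
Qed.

Lemma convex_signature0 (p : ncpoly R g) n (X : mxtuple R g n) v :
  nc_convex p -> symtuple X -> signature true p X v = 0%N.
Proof.
move=> pconv Xs; apply/eqP; rewrite -leqn0; apply: signature_le => U sU.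
rewrite leqn0 dimv_eq0 -subv0; apply/subvP => H HU; have [Hs _ pos] := sU H HU.
rewrite memv0; apply: contraT => /pos.
by rewrite expr1 mulN1r oppr_gt0 ltNge convex_ncder2_ge0.
Qed.

(** Convexity makes the negative signature 0 everywhere, so the lower bound at [K.+1] copies of a
    free Fock point reads [mu true * (K.+1 * n) <= K], which forces [mu true = 0]. *)
Lemma convex_deg_le2 (p : ncpoly R g) :
  nc_symmetric p -> nc_convex p -> (ncdeg p <= 2)%N.
Proof.
move=> ps pconv; have [mu [dmu _ _ [K lb] _]] := curvature_index ps.
suff mu0 : mu true = 0%N by have := dmu true; rewrite mu0.
have [n [X [v [n0 Xs fr]]]] := exists_sym_words_free R g (ncdeg p).-1.
have Xks : symtuple (dsum (fun _ : 'I_K.+1 => X)) by apply: symtuple_dsum.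
have := @words_free_dsum _ _ K.+1 (fun=> n) _ (fun=> X) (fun=> v) ord0 fr.
move=> /(lb true _ _ _ Xks); rewrite convex_signature0 // add0n.
rewrite sum_nat_const card_ord; case: (mu true) => // k.
rewrite leqNgt mulSn (leq_trans _ (leq_addr _ _)) //.
by rewrite leq_pmulr.
Qed.

End Convexity.

(** Clause (B) is read under the minimum degree hypothesis of (A)(ii), and its degree 2 as at most
    two, since both limits also vanish in degree below two. In (D) the set [S'] respects direct
    sums, as [S] does. *)
Theorem theorem1p4 (R : realType) (g : nat) (p : ncpoly R g)
    (psym : nc_symmetric p)
    (S : ncset R g) (SV : ncsubset S (ncvariety p))
    (Ssum : respects_direct_sums S) (S1 : S 1%N !=set0) :
  (forall s : bool, cvgn (signature_density s p S)) /\
  (min_degree_defining0 p S ->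
    forall s : bool, (ncdeg p)%:R <= 2 * signature_limit s p S + 2) /\
  (min_degree_defining0 p S ->
    (signature_limit sgn_minus p S = 0 -> nc_convex p /\ (ncdeg p <= 2)%N) /\
    (signature_limit sgn_plus p S = 0 -> nc_concave p /\ (ncdeg p <= 2)%N)) /\
  (nc_convex p ->
    (ncdeg p <= 2)%N /\
    forall (n : nat) (X : mxtuple R g n) (v : 'cV[R]_n), (0 < n)%N ->
      symtuple X -> signature sgn_minus p X v = 0%N) /\
  (nc_concave p ->
    (ncdeg p <= 2)%N /\
    forall (n : nat) (X : mxtuple R g n) (v : 'cV[R]_n), (0 < n)%N ->
      symtuple X -> signature sgn_plus p X v = 0%N) /\
  (min_degree_defining0 p S ->
    forall S' : ncset R g,
      ncsubset S' (ncvariety p) -> respects_direct_sums S' ->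
      S' 1%N !=set0 -> min_degree_defining0 p S' ->
      forall s : bool, signature_limit s p S = signature_limit s p S').
Proof.
have [mu [dmu mu0 ub [K lb] sgn]] := curvature_index psym.
(* Every such limit equals [mu s], which depends on [p] alone; (A)(ii), (B) and (D) follow from
   this. *)
have limE (T : ncset R g) s : ncsubset T (ncvariety p) ->
    respects_direct_sums T -> T 1%N !=set0 -> min_degree_defining0 p T ->
    signature_limit s p T = (mu s)%:R.
  move=> TV Tsum T1 Tmin.
  apply: (signature_limit_index psym TV Tsum T1 (ub s) (lb s)) => mus.
  (* In degree 0 the index is 0, and no free point is asked for. *)
  have [d0|d0] := posnP (ncdeg p); last exact: min_degree_free.
  by rewrite mu0 // d0 in mus.
split; first by move=> s; have [l [cl _ _]] := signature_density_cvg psym SV Ssum S1 s;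
  apply/cvg_ex; exists l.
split; first by move=> Smin s; rewrite limE // -natrM -natrD ler_nat.
split.
  move=> Smin; split; rewrite limE // => /eqP; rewrite pnatr_eq0 => /eqP mus.
    have d2 : (ncdeg p <= 2)%N by have := dmu true; rewrite mus.
    split=> //; apply: convex_of_ncder2_ge0 => // n X H v Xs Hs.
    by have := sgn true n X H v Xs Hs mus; rewrite expr1 mulN1r oppr_le0.
  have d2 : (ncdeg p <= 2)%N by have := dmu false; rewrite mus.
  split=> //; apply: convex_of_ncder2_ge0.
  - exact: nc_symmetricN.
  - by rewrite ncdegN.
  - move=> n X H v Xs Hs.
    have := sgn false n X H v Xs Hs mus; rewrite expr0 mul1r.
    by rewrite !ncder2E ncjetN !qformZ qformN; lra.
split.
  move=> pconv; split; first exact: convex_deg_le2.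
  by move=> n X v _ Xs; exact: convex_signature0.
split.
  move=> pconv; split.
    by rewrite -ncdegN; apply: convex_deg_le2 => //; exact: nc_symmetricN.
  move=> n X v _ Xs; rewrite -[sgn_plus]/(~~ sgn_minus) -signatureN.
  exact: convex_signature0.
by move=> Smin S' S'V S'sum S'1 S'min s; rewrite !limE.
Qed.
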